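(* Let $\mathbf{k}$ be a field and let $F\in\mathrm{Mod}_c(\mathbf{k}_{\mathbb{R}})$ be a constructible sheaf of $\mathbf{k}$-vector spaces on $\mathbb{R}$ with compact support. Then there exist a finite family of (nonempty) intervals $I_a$ of $\mathbb{R}$ and integers $n_a\ge1$, $a\in A$, such that $F\simeq\bigoplus_{a\in A}\mathbf{k}_{I_a}^{n_a}$. Moreover this decomposition is unique in the following sense: if $F\simeq\bigoplus_{b\in B}\mathbf{k}_{J_b}^{m_b}$ is another decomposition of this type and we assume that the intervals $I_a$, $a\in A$, are distinct as well as the intervals $J_b$, $b\in B$, then there exists a bijection $\sigma\colon A\to B$ such that $J_{\sigma(a)}=I_a$ and $m_{\sigma(a)}=n_a$ for all $a\in A$.
   Context: A sheaf on a real analytic manifold is constructible if there is a real analytic stratification such that its restriction to each stratum is constant of finite rank. Intervals may be open, closed or half-closed, including single points. For a locally closed subset $I\subset\mathbb{R}$, $\mathbf{k}_I$ is the constant sheaf on $I$ extended by zero to $\mathbb{R}$. *)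

(* Defs.v *)
From HB Require Import structures.
From mathcomp Require Import all_boot all_order all_algebra generic_quotient.
From mathcomp Require Import all_classical all_reals all_analysis.

Set SsrOldRewriteGoalsOrder.
Set Implicit Arguments.
Unset Strict Implicit.
Unset Printing Implicit Defensive.

Import Order.TTheory GRing.Theory Num.Theory.
Import numFieldNormedType.Exports.

Local Open Scope classical_set_scope.
Local Open Scope ring_scope.

Section Linear.
Context (k : fieldType).

Definition mk_linear (V W : lmodType k) (f : V -> W)
    (f_lin : linear f) : {linear V -> W} :=
  HB.pack f (GRing.isLinear.Build k V W *:%R f f_lin).

Record submod (V : lmodType k) := Submod {
  submod_pred :> V -> Prop;
  submod0 : submod_pred 0;
  submodP : forall (a : k) (u v : V),
    submod_pred u -> submod_pred v -> submod_pred (a *: u + v) }.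

Section SubmodType.
Context (V : lmodType k) (S : submod V).

Definition submod_mem : {pred V} := fun v => `[< S v >].

Fact submod_mem_closed : submod_closed submod_mem.
Proof.
split; first by apply/asboolP; exact: submod0.
by move=> a u v /asboolP Su /asboolP Sv; apply/asboolP; exact: submodP.
Qed.
HB.instance Definition _ :=
  GRing.isSubmodClosed.Build k V submod_mem submod_mem_closed.

Record submod_type := SubmodType {
  submod_val :> V;
  submod_valP : submod_val \in submod_mem }.
HB.instance Definition _ := [isSub for submod_val].
HB.instance Definition _ := [Choice of submod_type by <:].
HB.instance Definition _ := [SubChoice_isSubLmodule of submod_type by <:].

Definition submod_mk (v : V) (Sv : S v) : submod_type :=
  SubmodType (asboolT Sv).

Lemma submod_in (u : submod_type) : S (submod_val u).
Proof. exact: (asboolW (submod_valP u)). Qed.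

Lemma submod_val_inj : injective submod_val.
Proof. exact: val_inj. Qed.

Lemma submod_val_linear (a : k) (u v : submod_type) :
  submod_val (a *: u + v) = a *: submod_val u + submod_val v.
Proof. exact: (linearP (\val : submod_type -> V)). Qed.
End SubmodType.

Section SubmodMap.
Context (V W : lmodType k) (S : submod V) (S' : submod W).
Context (f : {linear V -> W}) (fS : forall v, S v -> S' (f v)).

Definition submod_map_fun (u : submod_type S) : submod_type S' :=
  submod_mk (fS (submod_in u)).

Fact submod_map_linear : linear submod_map_fun.
Proof.
move=> a u v; apply: submod_val_inj; rewrite submod_val_linear.
by rewrite -[LHS]/(f (submod_val (a *: u + v))) submod_val_linear linearP.
Qed.

Definition submod_map : {linear submod_type S -> submod_type S'} :=
  mk_linear submod_map_linear.
End SubmodMap.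

(* The product of a family of vector spaces. *)
Section DProd.
Context (T : Type) (V : T -> lmodType k).

Definition dprod : Type := forall t, V t.
HB.instance Definition _ := Choice.on dprod.

Let add (f g : dprod) : dprod := fun t => f t + g t.
Let opp (f : dprod) : dprod := fun t => - f t.
Let scale (a : k) (f : dprod) : dprod := fun t => a *: f t.

Fact dprod_addA : associative add.
Proof. by move=> f g h; apply/functional_extensionality_dep => t; apply: addrA. Qed.
Fact dprod_addC : commutative add.
Proof. by move=> f g; apply/functional_extensionality_dep => t; apply: addrC. Qed.
Fact dprod_add0 : left_id (fun t => 0 : V t) add.
Proof. by move=> f; apply/functional_extensionality_dep => t; apply: add0r. Qed.
Fact dprod_addN : left_inverse (fun t => 0 : V t) opp add.
Proof. by move=> f; apply/functional_extensionality_dep => t; apply: addNr. Qed.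
HB.instance Definition _ := GRing.isZmodule.Build dprod
  dprod_addA dprod_addC dprod_add0 dprod_addN.

Fact dprod_scaleA a b f : scale a (scale b f) = scale (a * b) f.
Proof. by apply/functional_extensionality_dep => t; apply: scalerA. Qed.
Fact dprod_scale1 : left_id 1 scale.
Proof. by move=> f; apply/functional_extensionality_dep => t; apply: scale1r. Qed.
Fact dprod_scaleDr : right_distributive scale +%R.
Proof. by move=> a f g; apply/functional_extensionality_dep => t; apply: scalerDr. Qed.
Fact dprod_scaleDl f : {morph scale^~ f : a b / a + b}.
Proof. by move=> a b; apply/functional_extensionality_dep => t; apply: scalerDl. Qed.
HB.instance Definition _ := GRing.Zmodule_isLmodule.Build k dprod
  dprod_scaleA dprod_scale1 dprod_scaleDr dprod_scaleDl.
End DProd.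

Fact dprod_reindex_linear (A B : Type) (f : A -> B) (V : B -> lmodType k) :
  linear (fun (s : dprod V) => (fun a => s (f a)) : dprod (fun a => V (f a))).
Proof. by []. Qed.

Definition dprod_reindex (A B : Type) (f : A -> B) (V : B -> lmodType k) :
    {linear dprod V -> dprod (fun a => V (f a))} :=
  mk_linear (@dprod_reindex_linear A B f V).

Fact dprod_map_linear (A : Type) (V W : A -> lmodType k)
    (f : forall a, {linear V a -> W a}) :
  linear (fun (s : dprod V) => (fun a => f a (s a)) : dprod W).
Proof.
by move=> a s t; apply/functional_extensionality_dep => x; exact: linearP.
Qed.

Definition dprod_map (A : Type) (V W : A -> lmodType k)
    (f : forall a, {linear V a -> W a}) : {linear dprod V -> dprod W} :=
  mk_linear (dprod_map_linear f).
End Linear.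

Identity Coercion set_Funclass : set >-> Funclass.

Record opens (T : topologicalType) := Opens {
  opens_set :> set T;
  opens_open : open opens_set }.

Section OpensOps.
Context (T : topologicalType).

Definition opensI (U V : opens T) : opens T :=
  Opens (openI (opens_open U) (opens_open V)).

Lemma opensIl (U V : opens T) : opensI U V `<=` U.
Proof. by move=> ? []. Qed.

Lemma opensIr (U V : opens T) : opensI U V `<=` V.
Proof. by move=> ? []. Qed.

Definition opensT : opens T := Opens openT.

Definition incl_set (U V : set T) (VU : V `<=` U) (x : V) : U :=
  exist _ (val x) (mem_set (VU _ (set_mem (valP x)))).

Lemma set_typeP (U : set T) (x : U) : U (val x).
Proof. exact: set_mem (valP x). Qed.

Definition to_set_type (U : set T) (x : T) (Ux : U x) : U := exist _ x (mem_set Ux).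
End OpensOps.

Section TraceOpen.
Context (T : topologicalType) (S : set T).

Fact trace_open (U : opens T) : open ((val : S -> T) @^-1` U).
Proof. by exists (U : set T) => //; exact: opens_open. Qed.

Definition trace (U : opens T) : opens (set_type S) := Opens (trace_open U).

Lemma traceS (U V : opens T) : V `<=` U -> trace V `<=` trace U.
Proof. by move=> VU x; exact: VU. Qed.
End TraceOpen.

Record presheaf (k : fieldType) (T : topologicalType) := Presheaf {
  sec :> opens T -> lmodType k;
  res : forall U V : opens T, V `<=` U -> {linear sec U -> sec V};
  res_id : forall (U : opens T) (UU : U `<=` U) (s : sec U), res UU s = s;
  res_comp : forall (U V W : opens T)
    (VU : V `<=` U) (WV : W `<=` V) (WU : W `<=` U) (s : sec U),
    res WV (res VU s) = res WU s }.
Arguments res {k T p U V} VU.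

(* The empty cover of the empty set is allowed, so that F set0 = 0. *)
Definition is_sheaf (k : fieldType) (T : topologicalType) (F : presheaf k T) :=
  forall (I : Type) (W : I -> opens T) (U : opens T)
    (WU : forall i, W i `<=` U) (s : forall i, F (W i)),
  U `<=` \bigcup_i W i ->
  (forall (i j : I) (N : opens T) (Ni : N `<=` W i) (Nj : N `<=` W j),
    res Ni (s i) = res Nj (s j)) ->
  exists! t : F U, forall i, res (WU i) t = s i.

Record sheaf (k : fieldType) (T : topologicalType) := Sheaf {
  sheaf_presheaf :> presheaf k T;
  sheafP : is_sheaf sheaf_presheaf }.

Record sheaf_hom (k : fieldType) (T : topologicalType) (F G : sheaf k T) :=
SheafHom {
  happ :> forall U : opens T, {linear F U -> G U};
  happ_res : forall (U V : opens T) (VU : V `<=` U) (s : F U),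
    happ V (res VU s) = res VU (happ U s) }.

Definition sheaf_iso (k : fieldType) (T : topologicalType) (F G : sheaf k T) :=
  exists (f : sheaf_hom F G) (g : sheaf_hom G F),
  (forall U, cancel (f U) (g U)) /\ (forall U, cancel (g U) (f U)).

(* Sheaves whose sections over U are families (s x)_(x in U) subject to a
   local condition P. *)
Section FunSheaf.
Context (k : fieldType) (T : topologicalType) (V : T -> lmodType k).
Notation fam U := (dprod (fun x : set_type (opens_set U) => V (val x))).
Context (P : forall U : opens T, submod (fam U)).

Lemma fam_irr (U : opens T) (s : fam U) (x : T) (p q : x \in opens_set U) :
  s (exist _ x p) = s (exist _ x q).
Proof. by rewrite (bool_irrelevance p q). Qed.

Definition fam_res (U W : opens T) (WU : W `<=` U) : {linear fam U -> fam W} :=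
  dprod_reindex (incl_set WU) _.

Context (P_res : forall (U W : opens T) (WU : W `<=` U) (s : fam U),
  P U s -> P W (fam_res WU s)).
Context (P_loc : forall (U : opens T) (s : fam U),
  (forall x, U x -> exists (N : opens T) (NU : N `<=` U),
     N x /\ P N (fam_res NU s)) -> P U s).

Definition fun_presheaf : presheaf k T.
Proof.
apply: (@Presheaf k T (fun U => submod_type (P U))
  (fun U W WU => submod_map (@P_res U W WU))).
- move=> U UU s; apply: submod_val_inj; apply/functional_extensionality_dep.
  by move=> [x Ux] /=; exact: (@fam_irr U (submod_val s)).
- move=> U W N WU NW NU s; apply: submod_val_inj.
  apply/functional_extensionality_dep.
  by move=> [x Ux] /=; exact: (@fam_irr U (submod_val s)).
Defined.

Definition fun_val (U : opens T) (s : fun_presheaf U) : fam U := submod_val s.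

Lemma fun_val_inj (U : opens T) : injective (@fun_val U).
Proof. exact: submod_val_inj. Qed.

Lemma fun_resE (U W : opens T) (WU : W `<=` U) (s : fun_presheaf U)
    (x : set_type W) :
  fun_val (res WU s) x = fun_val s (incl_set WU x).
Proof. by []. Qed.

Lemma fun_presheaf_is_sheaf : is_sheaf fun_presheaf.
Proof.
move=> I W U WU s cov compat.
have agree (i j : I) (x : T) (Wi : W i x) (Wj : W j x) :
    fun_val (s i) (to_set_type Wi) = fun_val (s j) (to_set_type Wj).
  have Ni : opensI (W i) (W j) `<=` W i by move=> ? [].
  have Nj : opensI (W i) (W j) `<=` W j by move=> ? [].
  have Nx : opensI (W i) (W j) x by [].
  have E : fun_val (s i) (incl_set Ni (to_set_type Nx)) =
      fun_val (s j) (incl_set Nj (to_set_type Nx)).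
    exact: (congr1 (fun t : fun_presheaf _ => fun_val t (to_set_type Nx))
      (compat i j (opensI (W i) (W j)) Ni Nj)).
  move: E; rewrite /incl_set /to_set_type /=.
  move: (mem_set (Ni _ _)) (mem_set (Nj _ _)) (mem_set Wi) (mem_set Wj).
  by move=> p q p' q'; rewrite (bool_irrelevance p' p) (bool_irrelevance q' q).
have /choice[c cP] (x : set_type U) : exists i, W i (val x).
  by have [i _ Wi] := cov _ (set_typeP x); exists i.
pose t : fam U := fun x => fun_val (s (c x)) (to_set_type (cP x)).
have tres i : fam_res (WU i) t = fun_val (s i).
  apply/functional_extensionality_dep => -[x Wx].
  rewrite /fam_res /dprod_reindex /= /t.
  by rewrite (agree _ i _ _ (set_mem Wx)); exact: (@fam_irr _ (fun_val _)).
have Pt : P U t.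
  apply: P_loc => x Ux; have [i _ Wi] := cov _ Ux.
  by exists (W i), (WU i); split=> //; rewrite tres; exact: submod_in.
exists (submod_mk Pt); split.
  by move=> i; apply: fun_val_inj; exact: tres.
move=> u uP; apply: fun_val_inj; apply/functional_extensionality_dep => -[x Ux] /=.
rewrite /t -[in LHS](uP (c _)) fun_resE; exact: (@fam_irr _ (fun_val _)).
Qed.

Definition fun_sheaf : sheaf k T := Sheaf fun_presheaf_is_sheaf.
End FunSheaf.

Arguments fun_sheaf {k T V} P P_res P_loc.

(* The constant sheaf with fibre M: locally constant functions to M. *)
Section ConstSheaf.
Context (k : fieldType) (T : topologicalType) (M : lmodType k).
Notation fam U := (dprod (fun _ : set_type (opens_set U) => M)).

Definition locally_constant (U : opens T) (s : fam U) : Prop :=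
  forall x : set_type U, exists N : opens T,
    N (val x) /\ forall y : set_type U, N (val y) -> s y = s x.

Fact locally_constant0 (U : opens T) : locally_constant (0 : fam U).
Proof. by move=> x; exists U; split=> //; exact: set_typeP. Qed.

Fact locally_constantP (U : opens T) (a : k) (s t : fam U) :
  locally_constant s -> locally_constant t -> locally_constant (a *: s + t).
Proof.
move=> sc tc x; have [N [Nx Ns]] := sc x; have [N' [N'x Nt]] := tc x.
exists (opensI N N'); split=> // y [Ny N'y].
by rewrite -[LHS]/(a *: s y + t y) (Ns _ Ny) (Nt _ N'y).
Qed.

Definition locally_constant_submod (U : opens T) : submod (fam U) :=
  Submod (@locally_constant0 U) (@locally_constantP U).

Fact locally_constant_res (U W : opens T) (WU : W `<=` U) (s : fam U) :
  locally_constant s -> locally_constant (fam_res (fun=> M) WU s).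
Proof.
move=> sc x; have [N [Nx Ns]] := sc (incl_set WU x).
by exists N; split=> // y Ny; exact: Ns.
Qed.

Fact locally_constant_loc (U : opens T) (s : fam U) :
  (forall x, U x -> exists (N : opens T) (NU : N `<=` U),
     N x /\ locally_constant (fam_res (fun=> M) NU s)) ->
  locally_constant s.
Proof.
move=> sc x; have [N [NU [Nx sN]]] := sc _ (set_typeP x).
have [N' [N'x sN']] := sN (to_set_type Nx).
exists (opensI N N'); split=> // y [Ny N'y].
have /= := sN' (to_set_type Ny) N'y.
have inclE (z : set_type U) (Nz : N (val z)) : incl_set NU (to_set_type Nz) = z.
  exact: val_inj.
by rewrite /fam_res /dprod_reindex /= !inclE.
Qed.

Definition const_sheaf : sheaf k T :=
  fun_sheaf (V := fun=> M) locally_constant_submod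
    locally_constant_res locally_constant_loc.
End ConstSheaf.

Section DirectSum.
Context (k : fieldType) (T : topologicalType) (A : finType).
Context (F : A -> sheaf k T).

Definition dsum_presheaf : presheaf k T.
Proof.
apply: (@Presheaf k T (fun U => dprod (fun a => F a U))
  (fun U V VU => dprod_map (fun a => @res k T (F a) U V VU))).
- move=> U UU s; apply/functional_extensionality_dep => a; exact: res_id.
- move=> U V W VU WV WU s; apply/functional_extensionality_dep => a.
  exact: res_comp.
Defined.

Lemma dsum_is_sheaf : is_sheaf dsum_presheaf.
Proof.
move=> I W U WU s cov compat.
have [t tP] : {t : dprod (fun a => F a U) &
    forall a, unique (fun t => forall i, res (WU i) t = s i a) (t a)}.
  have H a : {t | unique (fun t => forall i, res (WU i) t = s i a) t}.
    apply: cid; apply: (@sheafP _ _ (F a) I W U WU (s^~ a) cov) => i j N Ni Nj.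
    exact: (congr1 (fun f => f a) (compat i j N Ni Nj)).
  by exists (fun a => projT1 (H a)) => a; exact: (projT2 (H a)).
exists t; split.
  by move=> i; apply/functional_extensionality_dep => a; exact: (tP a).1.
move=> u uP; apply/functional_extensionality_dep => a.
by apply: (tP a).2 => i; rewrite -(uP i).
Qed.

(* A finite direct sum of sheaves is their product. *)
Definition dsum : sheaf k T := Sheaf dsum_is_sheaf.
End DirectSum.

Section Stalk.
Context (k : fieldType) (T : topologicalType) (F : sheaf k T) (x : T).

Record pregerm := Pregerm {
  pg_nbhd : opens T;
  pg_in : pg_nbhd x;
  pg_sec : F pg_nbhd }.
HB.instance Definition _ := gen_eqMixin pregerm.
HB.instance Definition _ := gen_choiceMixin pregerm.

Definition same_germ (p q : pregerm) : Prop :=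
  exists (W : opens T) (Wp : W `<=` pg_nbhd p) (Wq : W `<=` pg_nbhd q),
    W x /\ res Wp (pg_sec p) = res Wq (pg_sec q).

Definition same_germb : rel pregerm := fun p q => `[< same_germ p q >].

Fact same_germb_refl : reflexive same_germb.
Proof.
move=> p; apply/asboolP; have H : pg_nbhd p `<=` pg_nbhd p by [].
by exists (pg_nbhd p), H, H; split=> //; exact: pg_in.
Qed.

Fact same_germb_sym : symmetric same_germb.
Proof.
have H p q : same_germ p q -> same_germ q p.
  by move=> [W [Wp [Wq [Wx E]]]]; exists W, Wq, Wp; split.
by move=> p q; apply/asboolP/asboolP; exact: H.
Qed.

Fact same_germb_trans : transitive same_germb.
Proof.
move=> q p r /asboolP[W [Wp [Wq [Wx E]]]] /asboolP[W' [W'q [W'r [W'x E']]]].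
apply/asboolP; have H : opensI W W' `<=` W by move=> ? [].
have H' : opensI W W' `<=` W' by move=> ? [].
exists (opensI W W'), (subset_trans H Wp), (subset_trans H' W'r).
split=> //.
rewrite -(res_comp Wp H) E (res_comp Wq H (subset_trans H Wq)).
by rewrite -(res_comp W'r H') -E' (res_comp W'q H' (subset_trans H Wq)).
Qed.

Canonical same_germb_equiv :=
  EquivRel same_germb same_germb_refl same_germb_sym same_germb_trans.

Definition stalk : Type := {eq_quot same_germb}%qT.
HB.instance Definition _ := Choice.on stalk.

Definition germ (U : opens T) (Ux : U x) (s : F U) : stalk :=
  \pi_{eq_quot same_germb}%qT (Pregerm Ux s).

Lemma germP (U V : opens T) (Ux : U x) (Vx : V x) (s : F U) (t : F V) :
  germ Ux s = germ Vx t <->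
  exists (W : opens T) (WU : W `<=` U) (WV : W `<=` V),
    W x /\ res WU s = res WV t.
Proof.
split=> [/eqquotP/asboolP //|H]; exact/eqquotP/asboolP.
Qed.

Lemma germ_res (U V : opens T) (VU : V `<=` U) (Ux : U x) (Vx : V x) (s : F U) :
  germ Vx (res VU s) = germ Ux s.
Proof.
have VV : V `<=` V by [].
by apply/germP; exists V, VV, VU; split=> //; rewrite res_id.
Qed.

Lemma stalkP (g : stalk) : exists (U : opens T) (Ux : U x) (s : F U), g = germ Ux s.
Proof.
by elim/quotW: g => -[U Ux s]; exists U, Ux, s.
Qed.

Lemma stalk2P (g h : stalk) :
  exists (U : opens T) (Ux : U x) (s t : F U), g = germ Ux s /\ h = germ Ux t.
Proof.
have [U [Ux [s ->]]] := stalkP g; have [V [Vx [t ->]]] := stalkP h.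
have IU : opensI U V `<=` U by move=> ? [].
have IV : opensI U V `<=` V by move=> ? [].
have Ix : opensI U V x by [].
by exists (opensI U V), Ix, (res IU s), (res IV t); rewrite !germ_res.
Qed.

Lemma stalk3P (g h l : stalk) :
  exists (U : opens T) (Ux : U x) (s t u : F U),
    [/\ g = germ Ux s, h = germ Ux t & l = germ Ux u].
Proof.
have [U [Ux [s [t [-> ->]]]]] := stalk2P g h.
have [V [Vx [u ->]]] := stalkP l.
have IU : opensI U V `<=` U by move=> ? [].
have IV : opensI U V `<=` V by move=> ? [].
have Ix : opensI U V x by [].
exists (opensI U V), Ix, (res IU s), (res IU t), (res IV u).
by rewrite !germ_res.
Qed.

Let zero : stalk := germ (U := opensT T) I 0.

Let op (a : k) (g h : stalk) : stalk :=
  let p := repr g in let q := repr h in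
  germ (U := opensI (pg_nbhd p) (pg_nbhd q)) (conj (pg_in p) (pg_in q))
    (a *: res (@opensIl _ (pg_nbhd p) (pg_nbhd q)) (pg_sec p) +
      res (@opensIr _ (pg_nbhd p) (pg_nbhd q)) (pg_sec q)).

Let opE a (U : opens T) (Ux : U x) (s t : F U) :
  op a (germ Ux s) (germ Ux t) = germ Ux (a *: s + t).
Proof.
rewrite /op.
have : germ Ux s = germ (pg_in (repr (germ Ux s))) (pg_sec (repr (germ Ux s))).
  by rewrite -[LHS]reprK /germ; case: (repr _).
have : germ Ux t = germ (pg_in (repr (germ Ux t))) (pg_sec (repr (germ Ux t))).
  by rewrite -[LHS]reprK /germ; case: (repr _).
move: (repr (germ Ux s)) (repr (germ Ux t)) => -[V Vx s'] [W Wx t'] /=.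
move=> /germP[M [MU [MW [Mx Et]]]] /germP[N [NU [NV [Nx Es]]]].
apply/germP; exists (opensI N M).
have KI : opensI N M `<=` opensI V W by move=> y [/NV ? /MW ?].
have KU : opensI N M `<=` U by move=> y [/NU].
have KN : opensI N M `<=` N by move=> y [].
have KM : opensI N M `<=` M by move=> y [].
exists KI, KU; split=> //; rewrite !linearP.
rewrite !(res_comp _ _ (subset_trans KN NV)) !(res_comp _ _ (subset_trans KM MW)).
rewrite -(res_comp NV KN) -(res_comp MW KM) -Es -Et.
by rewrite (res_comp NU KN KU) (res_comp MU KM KU).
Qed.

Let zeroE (U : opens T) (Ux : U x) : zero = germ Ux 0.
Proof.
have UT : U `<=` opensT T by [].
by rewrite /zero -(germ_res UT _ Ux) linear0.
Qed.

Definition stalk_add (g h : stalk) : stalk := op 1 g h.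
Definition stalk_scale (a : k) (g : stalk) : stalk := op a g zero.
Definition stalk_opp (g : stalk) : stalk := op (-1) g zero.

Let addE (U : opens T) (Ux : U x) (s t : F U) :
  stalk_add (germ Ux s) (germ Ux t) = germ Ux (s + t).
Proof. by rewrite /stalk_add opE scale1r. Qed.

Let scaleE a (U : opens T) (Ux : U x) (s : F U) :
  stalk_scale a (germ Ux s) = germ Ux (a *: s).
Proof. by rewrite /stalk_scale (zeroE Ux) opE addr0. Qed.

Let oppE (U : opens T) (Ux : U x) (s : F U) :
  stalk_opp (germ Ux s) = germ Ux (- s).
Proof. by rewrite /stalk_opp (zeroE Ux) opE addr0 scaleN1r. Qed.

Fact stalk_addA : associative stalk_add.
Proof.
by move=> g h l; have [U [Ux [s [t [u [-> -> ->]]]]]] := stalk3P g h l;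
  rewrite !addE addrA.
Qed.
Fact stalk_addC : commutative stalk_add.
Proof.
by move=> g h; have [U [Ux [s [t [-> ->]]]]] := stalk2P g h;
  rewrite !addE addrC.
Qed.
Fact stalk_add0 : left_id zero stalk_add.
Proof.
by move=> g; have [U [Ux [s ->]]] := stalkP g; rewrite (zeroE Ux) addE add0r.
Qed.
Fact stalk_addN : left_inverse zero stalk_opp stalk_add.
Proof.
move=> g; have [U [Ux [s ->]]] := stalkP g.
by rewrite oppE addE addNr (zeroE Ux).
Qed.
HB.instance Definition _ := GRing.isZmodule.Build stalk
  stalk_addA stalk_addC stalk_add0 stalk_addN.

Fact stalk_scaleA a b g : stalk_scale a (stalk_scale b g) = stalk_scale (a * b) g.
Proof. by have [U [Ux [s ->]]] := stalkP g; rewrite !scaleE scalerA. Qed.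
Fact stalk_scale1 : left_id 1 stalk_scale.
Proof. by move=> g; have [U [Ux [s ->]]] := stalkP g; rewrite scaleE scale1r. Qed.
Fact stalk_scaleDr : right_distributive stalk_scale +%R.
Proof.
move=> a g h; have [U [Ux [s [t [-> ->]]]]] := stalk2P g h.
rewrite -[germ Ux s + germ Ux t]/(stalk_add _ _) addE !scaleE.
by rewrite -[RHS]/(stalk_add _ _) addE scalerDr.
Qed.
Fact stalk_scaleDl g : {morph stalk_scale^~ g : a b / a + b}.
Proof.
move=> a b; have [U [Ux [s ->]]] := stalkP g.
rewrite !scaleE.
by rewrite -[RHS]/(stalk_add _ _) addE scalerDl.
Qed.
HB.instance Definition _ := GRing.Zmodule_isLmodule.Build k stalk
  stalk_scaleA stalk_scale1 stalk_scaleDr stalk_scaleDl.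

Lemma germ_linear (U : opens T) (Ux : U x) : linear (germ Ux : F U -> stalk).
Proof.
move=> a s t.
by rewrite -[RHS]/(stalk_add (stalk_scale a _) _) scaleE addE.
Qed.
End Stalk.

(* The restriction F|_S of a sheaf to a subspace S: its sections over W are the
   families of germs (g x)_(x in W) which are locally the germs of a section
   of F. *)
Section InverseImage.
Context (k : fieldType) (T : topologicalType) (F : sheaf k T) (S : set T).
Notation X := (set_type S : topologicalType).
Notation fam W :=
  (dprod (fun x : set_type (opens_set W) => stalk F (val (val x)))).

Definition locally_section (W : opens X) (g : fam W) : Prop :=
  forall x : set_type W, exists (N : opens X) (U : opens T) (s : F U),
    N (val x) /\
    forall y : set_type W, N (val y) ->
      exists Uy : U (val (val y)), g y = germ Uy s.

Fact locally_section0 (W : opens X) : locally_section (0 : fam W).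
Proof.
move=> x; exists (opensT _), (opensT _), 0; split=> // y _; exists I.
by [].
Qed.

Fact locally_sectionP (W : opens X) (a : k) (g h : fam W) :
  locally_section g -> locally_section h -> locally_section (a *: g + h).
Proof.
move=> gP hP x; have [N [U [s [Nx gs]]]] := gP x.
have [N' [U' [s' [N'x hs]]]] := hP x.
exists (opensI N N'), (opensI U U'),
  (a *: res (@opensIl _ U U') s + res (@opensIr _ U U') s').
split=> // y [Ny N'y]; have [Uy gy] := gs y Ny; have [U'y hy] := hs y N'y.
have Iy : opensI U U' (val (val y)) by [].
exists Iy; rewrite germ_linear.
by rewrite -[LHS]/(a *: g y + h y) gy hy (germ_res _ Uy) (germ_res _ U'y).
Qed.

Definition locally_section_submod (W : opens X) : submod (fam W) :=
  Submod (@locally_section0 W) (@locally_sectionP W).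

Fact locally_section_res (U W : opens X) (WU : W `<=` U) (g : fam U) :
  locally_section g ->
  locally_section (fam_res (fun x : X => stalk F (val x)) WU g).
Proof.
move=> gP x; have [N [Q [s [Nx gs]]]] := gP (incl_set WU x).
by exists N, Q, s; split=> // y Ny; exact: (gs (incl_set WU y)).
Qed.

Fact locally_section_loc (W : opens X) (g : fam W) :
  (forall x, W x -> exists (N : opens X) (NW : N `<=` W),
     N x /\ locally_section (fam_res (fun x : X => stalk F (val x)) NW g)) ->
  locally_section g.
Proof.
move=> gP x; have [N [NW [Nx gN]]] := gP _ (set_typeP x).
have [N' [U [s [N'x gN']]]] := gN (to_set_type Nx).
exists (opensI N N'), U, s; split=> // -[y Wy] [Ny N'y].
have [Uy E] := gN' (to_set_type Ny) N'y; exists Uy.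
by rewrite -E /=; exact: (fam_irr (V := fun x : X => stalk F (val x))).
Qed.

Definition restriction : sheaf k X :=
  fun_sheaf locally_section_submod locally_section_res locally_section_loc.
End InverseImage.

(* A section is supported at x when it vanishes on no neighbourhood of x, and
   sheaf_supp F is the complement of the largest open set N with F|_N = 0. *)
Section Support.
Context (k : fieldType) (T : topologicalType) (F : sheaf k T).

Definition sec_supp (U : opens T) (s : F U) : set T :=
  [set x | U x /\
    ~ exists (N : opens T) (NU : N `<=` U), N x /\ res NU s = 0].

Definition sheaf_supp : set T :=
  [set x | ~ exists N : opens T, N x /\
    forall U : opens T, U `<=` N -> forall s : F U, s = 0].

Lemma sec_supp0 (U : opens T) : sec_supp (0 : F U) = set0.
Proof.
rewrite predeqE => x; split=> // -[Ux []].
have UU : U `<=` U by [].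
by exists U, UU; rewrite linear0.
Qed.

Lemma sec_suppP (U : opens T) (a : k) (s t : F U) :
  sec_supp (a *: s + t) `<=` sec_supp s `|` sec_supp t.
Proof.
move=> x [Ux H]; apply: contrapT => /not_orP[Hs Ht].
have [N [NU [Nx sN]]] :
    exists (N : opens T) (NU : N `<=` U), N x /\ res NU s = 0.
  by apply: contrapT => K; exact: Hs.
have [N' [N'U [N'x tN']]] :
    exists (N : opens T) (NU : N `<=` U), N x /\ res NU t = 0.
  by apply: contrapT => K; exact: Ht.
apply: H; have IU : opensI N N' `<=` U by move=> y [/NU].
exists (opensI N N'), IU; split=> //; rewrite linearP.
rewrite -(res_comp NU (@opensIl _ N N')) -(res_comp N'U (@opensIr _ N N')).
by rewrite sN tN' !linear0 addr0.
Qed.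

Lemma sec_supp_res (U V : opens T) (VU : V `<=` U) (s : F U) :
  sec_supp (res VU s) = sec_supp s `&` V.
Proof.
rewrite predeqE => x; split=> [[Vx H]|[[Ux H] Vx]].
  split=> //; split; first exact: (VU x).
  move=> [N [NU [Nx sN]]]; apply: H.
  exists (opensI N V), (@opensIr _ N V); split=> //.
  have IU : opensI N V `<=` U by move=> y [/NU].
  by rewrite (res_comp VU _ IU) -(res_comp NU (@opensIl _ N V)) sN linear0.
split=> // -[N [NV [Nx sN]]]; apply: H.
by exists N, (subset_trans NV VU); split=> //; rewrite -(res_comp VU NV).
Qed.

Lemma sec_supp_closed (U : opens T) (s : F U) (x : T) :
  U x -> ~ sec_supp s x -> exists N : opens T,
    [/\ N x, N `<=` U & N `&` sec_supp s = set0].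
Proof.
move=> Ux xs.
have [N [NU [Nx sN]]] :
    exists (N : opens T) (NU : N `<=` U), N x /\ res NU s = 0.
  by apply: contrapT => K; exact: xs.
exists N; split=> //; rewrite predeqE => y; split=> // -[Ny [_ []]].
by exists N, NU.
Qed.
End Support.

(* The extension by zero j_! G of a sheaf G on a locally closed subset S, where
   j : S -> T is the inclusion: its sections over U are the sections of G over
   S `&` U whose support, seen in T, is closed in U, that is, contains all
   its limit points in U. *)
Section ExtZero.
Context (k : fieldType) (T : topologicalType) (S : set T).
Context (G : sheaf k (set_type S)).

Definition ext_supp (U : opens T) (s : G (trace S U)) : set T :=
  (val : S -> T) @` sec_supp s.

Definition supp_closed_in (U : opens T) (s : G (trace S U)) : Prop :=
  U `&` closure (ext_supp s) `<=` ext_supp s.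

Fact supp_closed_in0 (U : opens T) : supp_closed_in (0 : G (trace S U)).
Proof. by rewrite /supp_closed_in /ext_supp sec_supp0 image_set0 closure0 setI0. Qed.

Fact supp_closed_inP (U : opens T) (a : k) (s t : G (trace S U)) :
  supp_closed_in s -> supp_closed_in t -> supp_closed_in (a *: s + t).
Proof.
move=> sP tP x [Ux clx].
have [y yx] : exists y : S, val y = x.
  have : closure (ext_supp s `|` ext_supp t) x.
    apply: closureS clx => _ [y /sec_suppP[ys|yt] <-].
      by left; exists y.
    by right; exists y.
  rewrite closureU => -[cs|ct].
    by have [y _ <-] := sP _ (conj Ux cs); exists y.
  by have [y _ <-] := tP _ (conj Ux ct); exists y.
exists y => //; apply: contrapT => ny.
have Uy : trace S U y by rewrite /= yx.
have [N [Ny _ Ndis]] := sec_supp_closed Uy ny.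
have [Q oQ QN] := opens_open N.
have Qx : Q x by rewrite -yx; move: Ny; rewrite -QN.
have [_ [[z zs <-] Qz]] := clx Q (open_nbhs_nbhs (conj oQ Qx)).
have : (N `&` sec_supp (a *: s + t)) z by split=> //; rewrite -QN.
by rewrite Ndis.
Qed.

Definition ext_submod (U : opens T) : submod (G (trace S U)) :=
  Submod (@supp_closed_in0 U) (@supp_closed_inP U).

Fact supp_closed_in_res (U V : opens T) (VU : V `<=` U) (s : G (trace S U)) :
  supp_closed_in s -> supp_closed_in (res (traceS VU) s).
Proof.
move=> sP x [Vx clx].
have [y ys yx] : ext_supp s x.
  apply: sP; split; first exact: (VU x).
  apply: closureS clx; rewrite /ext_supp sec_supp_res.
  by move=> _ [y [ys _] <-]; exists y.
by exists y => //; rewrite sec_supp_res; split=> //=; rewrite yx.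
Qed.

Definition ext_presheaf : presheaf k T.
Proof.
apply: (@Presheaf k T (fun U => submod_type (ext_submod U))
  (fun U V VU => submod_map (S := ext_submod U) (S' := ext_submod V)
    (f := res (traceS VU)) (@supp_closed_in_res U V VU))).
- by move=> U UU s; apply: submod_val_inj; exact: res_id.
- by move=> U V W VU WV WU s; apply: submod_val_inj; exact: res_comp.
Defined.

Definition ext_val (U : opens T) (s : ext_presheaf U) : G (trace S U) :=
  submod_val s.

Lemma ext_val_inj (U : opens T) : injective (@ext_val U).
Proof. exact: submod_val_inj. Qed.

Lemma ext_resE (U V : opens T) (VU : V `<=` U) (s : ext_presheaf U) :
  ext_val (res VU s) = res (traceS VU) (ext_val s).
Proof. by []. Qed.

Lemma ext_is_sheaf : is_sheaf ext_presheaf.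
Proof.
move=> I W U WU s cov compat.
have [] := @sheafP _ _ G I (fun i => trace S (W i)) (trace S U)
  (fun i => traceS (WU i)) (fun i => ext_val (s i)).
- by move=> x Ux; have [i _ Wi] := cov _ Ux; exists i.
- move=> i j N Ni Nj.
  have IE := congr1 (@ext_val _) (compat i j (opensI (W i) (W j))
    (@opensIl _ _ _) (@opensIr _ _ _)).
  have NI : N `<=` trace S (opensI (W i) (W j)).
    by move=> x Nx; split; [exact: Ni|exact: Nj].
  have := congr1 (res NI) IE.
  by rewrite !ext_resE (res_comp _ NI Ni) (res_comp _ NI Nj).
move=> t [tP t_uniq].
have Pt : ext_submod U t.
  move=> x [Ux clx]; have [i _ Wi] := cov _ Ux.
  have [y ys yx] : ext_supp (ext_val (s i)) x.
    apply: (submod_in (s i)); split=> // N Nx.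
    have [_ [[z zs <-] [Nz Wz]]] :=
      clx _ (filterI Nx (open_nbhs_nbhs (conj (opens_open (W i)) Wi))).
    exists (val z); split=> //; exists z => //.
    by rewrite -[submod_val _]/(ext_val (s i)) -(tP i) sec_supp_res.
  exists y => //; move: ys; rewrite -(tP i) sec_supp_res; exact: proj1.
exists (submod_mk Pt : ext_presheaf U); split.
  by move=> i; apply: ext_val_inj; exact: tP.
move=> u uP; apply: ext_val_inj; apply: t_uniq => i.
by rewrite -ext_resE uP.
Qed.

Definition ext_zero : sheaf k T := Sheaf ext_is_sheaf.
End ExtZero.

(* The sheaf k_I; meaningful for locally closed I, such as the intervals of
   the real line. *)
Definition k_sheaf (k : fieldType) (T : topologicalType) (I : set T) :
    sheaf k T :=
  ext_zero (const_sheaf (set_type I) (k^o : lmodType k)).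

Definition dsum_pow (k : fieldType) (T : topologicalType) (n : nat)
    (F : sheaf k T) : sheaf k T :=
  dsum (fun _ : 'I_n => F).

Definition constant_of_finite_rank (k : fieldType) (T : topologicalType)
    (F : sheaf k T) : Prop :=
  exists r : nat, sheaf_iso F (const_sheaf T ('rV[k]_r : lmodType k)).

Section Stratification.
Context (R : realType).

Definition analytic_at (f : R -> R) (x : R) : Prop :=
  exists a : R^nat, \forall y \near x, pseries a (y - x) @ \oo --> f y.

(* A real analytic diffeomorphism from U onto an open subset of the line. *)
Definition analytic_chart (U : set R) (phi : R -> R) : Prop :=
  [/\ open U, open (phi @` U), {in U, forall x, analytic_at phi x} &
    exists psi : R -> R, {in U, cancel phi psi} /\
      {in phi @` U, forall y, analytic_at psi y}].

(* Near each point, S corresponds in a chart to a linear subspace of the line: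
   the line itself (dimension 1) or the origin (dimension 0). *)
Definition analytic_submanifold (S : set R) : Prop :=
  forall x, S x -> exists (U : set R) (phi : R -> R),
    [/\ U x, analytic_chart U phi &
      S `&` U = U \/ S `&` U = U `&` phi @^-1` [set 0]].

Definition locally_finite (P : set (set R)) : Prop :=
  forall x : R, exists U : set R,
    nbhs x U /\ finite_set (P `&` [set S | S `&` U !=set0]).

(* A locally finite partition into connected submanifolds satisfying the
   frontier condition. *)
Definition analytic_stratification (P : set (set R)) : Prop :=
  [/\ partition P id [set: R], locally_finite P,
      forall S, P S -> connected S /\ analytic_submanifold S &
      forall S S', P S -> P S' ->
        closure S `&` S' !=set0 -> S' `<=` closure S].

Definition constructible (k : fieldType) (F : sheaf k R) : Prop :=
  exists P : set (set R), analytic_stratification P /\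
    forall S, P S -> constant_of_finite_rank (restriction F S).
End Stratification.

Definition interval_decomposition (R : realType) (k : fieldType)
    (F : sheaf k R) (A : finType) (I : A -> set R) (n : A -> nat) : Prop :=
  [/\ forall a, is_interval (I a), forall a, I a !=set0,
      forall a, (1 <= n a)%N &
      sheaf_iso F (dsum (fun a => dsum_pow (n a) (k_sheaf k (I a))))].

(* Main.v *)
(* Existence. By compactness of the support, finitely many points cut the line
   into open intervals on which F is constant. The stalks at these points and at
   one point of each interval form a zigzag, two neighbouring germs being related
   when they come from one section. A zigzag of finite-dimensional spaces has a
   barcode: go through it from left to right, pushing forward the flag of
   subspaces that records where elements are born, then choose bases adapted to
   these flags from right to left, lifting each basis vector to the previous
   space as deep in the flag as possible. A bar with its germs is a morphism
   k_I -> F, and since the bars through a point give a basis of the stalk there,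
   the sum of these morphisms is an isomorphism.

   Uniqueness. A morphism between k_I and k_J is multiplication by a constant on
   the intersection of I and J, so a composite k_I -> k_J -> k_I vanishes when
   J <> I. Hence, in an isomorphism of two decompositions, the identity matrix of
   size the multiplicity of I in one factors through the multiplicity of I in
   the other. *)

Require Import Defs.
From HB Require Import structures.
From mathcomp Require Import all_boot all_order all_algebra.
From mathcomp Require Import zify finmap.
From mathcomp Require Import all_classical all_reals all_analysis.

Set Implicit Arguments.
Unset Strict Implicit.
Unset Printing Implicit Defensive.

Import Order.TTheory GRing.Theory Num.Theory.
Import numFieldNormedType.Exports.

Local Open Scope classical_set_scope.
Local Open Scope ring_scope.

(** * Sections and germs *)

(** A germ at a cut point extends into both adjacent intervals, so the maps between stalks run from
    points to intervals and alternate in direction along the line. Linear relations treat both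
    directions alike, which leaves a single induction step for zigzags. The obstacle in that step is
    that the bars already chosen must be lifted one by one: the vectors related to 0, those related
    to something, and all earlier births must each be spanned by basis vectors, and this has to be
    arranged before the basis is chosen. The flag carries these conditions.

    For uniqueness, [k_I] may have no global section equal to 1 on [I]; but an interval is closed in
    some open set [U], and over [U] the function 1 on [I] is a section. The images of these unit
    sections turn a morphism into a matrix of functions. Constancy is established only for round
    trips [k_I -> k_J -> k_I], along [I], so that connectedness of each interval suffices and
    intersections need not be examined. *)

Section Germs.
Context (k : fieldType) (T : topologicalType) (F : sheaf k T).

Definition germ_lin (x : T) (U : opens T) (Ux : U x) : {linear F U -> stalk F x} :=
  mk_linear (germ_linear Ux).

Lemma germ0 (x : T) (U : opens T) (Ux : U x) : germ Ux (0 : F U) = 0.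
Proof. exact: (linear0 (germ_lin Ux)). Qed.

Lemma germ_irr (x : T) (U : opens T) (p q : U x) (s : F U) : germ p s = germ q s.
Proof. by rewrite (Prop_irrelevance p q). Qed.

Lemma sec_eq_germ (U : opens T) (s t : F U) :
  (forall x (Ux : U x), germ Ux s = germ Ux t) -> s = t.
Proof.
move=> st.
have H (x : set_type U) : exists (W : opens T) (WU : W `<=` U),
    W (val x) /\ res WU s = res WU t.
  have /germP[W [W1 [W2 [Wx E]]]] := st _ (set_typeP x).
  by exists W, W1; split=> //; rewrite E (Prop_irrelevance W2 W1).
have /choice[W WP] := H.
have WU x : W x `<=` U by have [] := WP x.
have E x : res (WU x) s = res (WU x) t.
  by have [h [_ e]] := WP x; rewrite (Prop_irrelevance (WU x) h).
have [] := @sheafP _ _ F _ W U WU (fun x => res (WU x) t).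
- move=> x Ux; exists (to_set_type Ux) => //.
  by have [_ [Wx _]] := WP (to_set_type Ux).
- move=> i j N Ni Nj.
  by rewrite !(res_comp _ _ (subset_trans Ni (WU i))).
- by move=> u [_ uu]; rewrite -(uu s E) -(uu t).
Qed.

(** Continuity at [x] of a section of the étalé space of [F]. Fields of germs are total, so that
    sums and gluing need no restriction maps. *)
Definition is_local_section (g : forall x, stalk F x) (x : T) : Prop :=
  exists (N : opens T) (s : F N), N x /\ forall y (Ny : N y), germ Ny s = g y.

(** [F] is the sheaf of sections of its étalé space: local representatives are compatible because
    they have the same germs. *)
Lemma glue_germs (U : opens T) (g : forall x, stalk F x) :
  (forall x, U x -> is_local_section g x) ->
  exists t : F U, forall x (Ux : U x), germ Ux t = g x.
Proof.
move=> gl.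
have H (x : set_type U) : exists (W : opens T) (s : F W),
    [/\ W (val x), W `<=` U & forall y (Wy : W y), germ Wy s = g y].
  have [N [s [Nx sg]]] := gl _ (set_typeP x).
  exists (opensI N U), (res (@opensIl _ N U) s); split.
  - by split => //; exact: set_typeP.
  - exact: opensIr.
  - by move=> y Wy; rewrite (germ_res _ Wy.1 Wy).
pose W x := projT1 (cid (H x)).
pose s x : F (W x) := projT1 (cid (projT2 (cid (H x)))).
have WP x : [/\ W x (val x), W x `<=` U & forall y (Wy : W x y), germ Wy (s x) = g y].
  exact: (projT2 (cid (projT2 (cid (H x))))).
have WU x : W x `<=` U by have [] := WP x.
have [] := @sheafP _ _ F _ W U WU s.
- move=> x Ux; exists (to_set_type Ux) => //.
  by have [Wx _ _] := WP (to_set_type Ux).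
- move=> i j N Ni Nj; apply: sec_eq_germ => x Nx.
  rewrite (germ_res _ (Ni _ Nx)) (germ_res _ (Nj _ Nx)).
  by have [_ _ ->] := WP i; have [_ _ ->] := WP j.
- move=> t [tP _]; exists t => x Ux.
  have [Wx _ sg] := WP (to_set_type Ux).
  by rewrite -(germ_res (WU (to_set_type Ux)) Ux Wx) tP sg.
Qed.

Lemma is_local_section_sum (I : Type) (r : seq I) (P : pred I)
    (g : I -> forall x, stalk F x) (x : T) :
  (forall i, P i -> is_local_section (g i) x) ->
  is_local_section (fun y => \sum_(i <- r | P i) g i y) x.
Proof.
move=> gl; elim: r => [|i r [N [s [Nx sN]]]].
  exists (opensT T), 0; split=> // y Ny; rewrite big_nil.
  exact: germ0.
case Pi : (P i); last first.
  by exists N, s; split=> // y Ny; rewrite big_cons Pi sN.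
have [N' [s' [N'x sN']]] := gl _ Pi.
exists (opensI N' N), (res (@opensIl _ N' N) s' + res (@opensIr _ N' N) s).
split=> // y Ny; rewrite big_cons Pi -[LHS]/(germ_lin Ny _) linearD /=.
by rewrite (germ_res _ Ny.1 Ny) (germ_res _ Ny.2 Ny) sN sN'.
Qed.

Lemma is_local_sectionZ (a : k) (g : forall x, stalk F x) (x : T) :
  is_local_section g x -> is_local_section (fun y => a *: g y) x.
Proof.
move=> [N [s [Nx sN]]]; exists N, (a *: s); split=> // y Ny.
by rewrite -[LHS]/(germ_lin Ny _) linearZ /= sN.
Qed.

Lemma is_local_section_near (g h : forall x, stalk F x) (x : T) (M : opens T) :
  M x -> (forall y, M y -> g y = h y) ->
  is_local_section g x -> is_local_section h x.
Proof.
move=> Mx gh [N [s [Nx sN]]]; exists (opensI N M), (res (@opensIl _ N M) s).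
by split=> // y Ny; rewrite (germ_res _ Ny.1 Ny) sN gh //; case: Ny.
Qed.

End Germs.

(** An isomorphism given by its graph. Neither direction needs a formula: linearity and naturality
    of the chosen maps follow from uniqueness of partners. *)
Lemma sheaf_iso_of_rel (k : fieldType) (T : topologicalType) (F G : sheaf k T)
    (Q : forall U : opens T, F U -> G U -> Prop) :
  (forall U a s t s' t', Q U s s' -> Q U t t' -> Q U (a *: s + t) (a *: s' + t')) ->
  (forall U s, exists s', Q U s s') -> (forall U s', exists s, Q U s s') ->
  (forall U s t s', Q U s s' -> Q U t s' -> s = t) ->
  (forall U s s' t', Q U s s' -> Q U s t' -> s' = t') ->
  (forall (U V : opens T) (VU : V `<=` U) s s',
     Q U s s' -> Q V (res VU s) (res VU s')) ->
  sheaf_iso F G.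
Proof.
move=> Qlin Qtot Qtot' Quniq Quniq' Qres.
pose f U s := projT1 (cid (Qtot U s)).
have fP U s : Q U s (f U s) := projT2 (cid (Qtot U s)).
pose g U s := projT1 (cid (Qtot' U s)).
have gP U s : Q U (g U s) s := projT2 (cid (Qtot' U s)).
have flin U : linear (f U).
  by move=> a s t; apply: Quniq' (fP _ _) (Qlin _ _ _ _ _ _ (fP _ _) (fP _ _)).
have glin U : linear (g U).
  by move=> a s t; apply: Quniq (gP _ _) (Qlin _ _ _ _ _ _ (gP _ _) (gP _ _)).
have fres (U V : opens T) (VU : V `<=` U) s :
    mk_linear (flin V) (res VU s) = res VU (mk_linear (flin U) s).
  by apply: Quniq' (fP _ _) (Qres _ _ _ _ _ (fP _ _)).
have gres (U V : opens T) (VU : V `<=` U) s :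
    mk_linear (glin V) (res VU s) = res VU (mk_linear (glin U) s).
  by apply: Quniq (gP _ _) (Qres _ _ _ _ _ (gP _ _)).
exists (SheafHom fres), (SheafHom gres); split=> U s /=.
  by apply: Quniq (gP _ _) (fP _ _).
by apply: Quniq' (fP _ _) (gP _ _).
Qed.

(** * Sections of k_I *)

Section ConstVal.
Context (k : fieldType) (X : topologicalType) (M : lmodType k).

Definition const_val (U : opens X) (s : const_sheaf X M U) :
  dprod (fun _ : set_type (opens_set U) => M) := fun_val s.

Lemma const_val_inj (U : opens X) : injective (@const_val U).
Proof. exact: fun_val_inj. Qed.

Lemma const_valP (U : opens X) (a : k) (s t : const_sheaf X M U) x :
  const_val (a *: s + t) x = a *: const_val s x + const_val t x.
Proof. by []. Qed.

Lemma const_val_lc (U : opens X) (s : const_sheaf X M U) :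
  locally_constant (const_val s).
Proof. exact: (submod_in (s : submod_type _)). Qed.

Lemma const_val_res (U V : opens X) (VU : V `<=` U) (s : const_sheaf X M U) x :
  const_val (res VU s) x = const_val s (incl_set VU x).
Proof. by []. Qed.

Definition const_mk (U : opens X) (f : dprod (fun _ : set_type (opens_set U) => M))
  (fP : locally_constant f) : const_sheaf X M U :=
  submod_mk (fP : locally_constant_submod _ _ f).

Lemma const_mkE (U : opens X) (f : dprod (fun _ : set_type (opens_set U) => M))
  (fP : locally_constant f) : const_val (const_mk fP) = f.
Proof. by []. Qed.
End ConstVal.

Section KSheaf.
Context (k : fieldType) (T : topologicalType) (I : set T).

(** A total function with default value 0, so that sections over different open sets or on different
    intervals are compared without subtypes. *)
Definition kval (U : opens T) (s : k_sheaf k I U) (x : T) : k :=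
  match pselect (I x), pselect (U x) with
  | left Ix, left Ux => const_val (ext_val s)
      (@to_set_type _ (trace I U) (to_set_type Ix) Ux)
  | _, _ => 0
  end.

Lemma kvalE (U : opens T) (s : k_sheaf k I U) (z : set_type (trace I U)) :
  kval s (val (val z)) = const_val (ext_val s) z.
Proof.
rewrite /kval; case: pselect => [Ix|nIx]; last first.
  by case: nIx; exact: set_typeP.
case: pselect => [Ux|nUx]; last by case: nUx; exact: (set_typeP z).
by apply: congr1; apply: val_inj; apply: val_inj.
Qed.

Lemma kval_out (U : opens T) (s : k_sheaf k I U) (x : T) : ~ I x -> kval s x = 0.
Proof. by move=> nIx; rewrite /kval; case: pselect. Qed.

Lemma ext_valP (U : opens T) (a : k) (s t : k_sheaf k I U) :
  ext_val (a *: s + t) = a *: ext_val s + ext_val t.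
Proof. exact: submod_val_linear. Qed.

Lemma kval_linear (U : opens T) (a : k) (s t : k_sheaf k I U) (x : T) :
  kval (a *: s + t) x = a * kval s x + kval t x.
Proof.
rewrite /kval; case: pselect => [Ix|_]; last by rewrite mulr0 addr0.
case: pselect => [Ux|_]; last by rewrite mulr0 addr0.
by rewrite ext_valP const_valP.
Qed.

Lemma kval_res (U V : opens T) (VU : V `<=` U) (s : k_sheaf k I U) (x : T) :
  V x -> kval (res VU s) x = kval s x.
Proof.
move=> Vx; have [Ix|nIx] := pselect (I x); last by rewrite !kval_out.
pose z := @to_set_type _ (trace I V) (to_set_type Ix) Vx.
rewrite -[x]/(val (val z)) kvalE ext_resE const_val_res -kvalE.
by [].
Qed.

Lemma kval_inj (U : opens T) (s t : k_sheaf k I U) :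
  (forall x, U x -> kval s x = kval t x) -> s = t.
Proof.
move=> st; apply: ext_val_inj; apply: const_val_inj.
apply/functional_extensionality_dep => z; rewrite -!kvalE; apply: st.
exact: (set_typeP z).
Qed.

(** At a point of [I] this is local constancy. At a point of [U] outside [I] it is the closed
    support, which leaves a neighbourhood where the section vanishes. *)
Lemma kval_local (U : opens T) (s : k_sheaf k I U) (x : T) : U x ->
  exists N : opens T, N x /\ forall y, N y -> U y -> I y -> kval s y = kval s x.
Proof.
move=> Ux; have [Ix|nIx] := pselect (I x).
  pose z := @to_set_type _ (trace I U) (to_set_type Ix) Ux.
  have [N [Nz Ns]] := const_val_lc (ext_val s) z.
  have [Q oQ QN] := opens_open N.
  exists (Opens oQ); split; first by move: Nz; rewrite -QN.
  move=> y Qy Uy Iy; pose w := @to_set_type _ (trace I U) (to_set_type Iy) Uy.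
  rewrite -[y]/(val (val w)) -[x]/(val (val z)) !kvalE; apply: Ns.
  by rewrite -QN.
have ncl : ~ closure (ext_supp (ext_val s)) x.
  move=> cl; apply: nIx; have [y _ <-] : ext_supp (ext_val s) x.
    exact: (submod_in (s : submod_type _)).
  exact: set_typeP.
have : ~ (closure (ext_supp (ext_val s))) x by [].
rewrite -[~ _]/((~` closure _) x) -interiorC => nx.
exists (Opens (@open_interior _ (~` ext_supp (ext_val s)))); split; first exact: nx.
move=> y /= ny Uy Iy; rewrite (kval_out _ nIx).
pose w := @to_set_type _ (trace I U) (to_set_type Iy) Uy.
rewrite -[y]/(val (val w)) kvalE.
have : ~ sec_supp (ext_val s) (val w).
  by move=> ws; apply: (interior_subset ny); exists (val w).
move=> /not_andP[/(_ Uy)//|/contrapT[N [NU [Nw rN]]]].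
pose w' := @to_set_type _ N (val w) Nw.
have -> : w = incl_set NU w' by exact: val_inj.
by rewrite -const_val_res rN.
Qed.

(** Converse of [kval_out] and [kval_local]. At points outside [I], the second hypothesis makes [f]
    vanish on [I] nearby, which is what closes the support in [U]. *)
Lemma kval_mk (U : opens T) (f : T -> k) :
  (forall x, ~ I x -> f x = 0) ->
  (forall x, U x -> exists N : opens T,
     N x /\ forall y, N y -> U y -> I y -> f y = f x) ->
  exists s : k_sheaf k I U, forall x, U x -> kval s x = f x.
Proof.
move=> f0 floc.
pose g : dprod (fun _ : set_type (opens_set (trace I U)) => (k^o : lmodType k)) :=
  fun z => f (val (val z)).
have gP : locally_constant g.
  move=> z; have [N [Nz Nf]] := floc _ (set_typeP z).
  exists (trace I N); split=> // w Nw; apply: Nf => //; last exact: set_typeP.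
  exact: (set_typeP w).
have gs : supp_closed_in (const_mk gP).
  move=> x [Ux clx]; have [N [Nx Nf]] := floc _ Ux.
  (* If [f x] were 0, [f] would vanish on [I] near [x], which is a limit point of the support. *)
  have zero : f x = 0 -> False.
    move=> fx0.
    have [_ [[z [Uz zs] <-] Nz]] := clx N (open_nbhs_nbhs (conj (opens_open N) Nx)).
    apply: zs; exists (opensI (trace I U) (trace I N)), (@opensIl _ _ _); split=> //.
    apply: const_val_inj; apply/functional_extensionality_dep => w.
    rewrite const_val_res const_mkE /g /= [LHS]Nf //.
    - by have [_] := set_typeP w.
    - by have [] := set_typeP w.
    - exact: set_typeP.
  have [Ix|/f0//] := pselect (I x).
  exists (to_set_type Ix) => //; split=> // -[N' [N'U [N'x rN]]].
  apply: zero.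
  have := congr1 (fun t => const_val t (@to_set_type _ N' (to_set_type Ix) N'x)) rN.
  by rewrite const_val_res const_mkE.
exists (submod_mk (gs : ext_submod _ _ (const_mk gP)) : k_sheaf k I U) => x Ux.
have [Ix|nIx] := pselect (I x); last by rewrite kval_out ?f0.
by rewrite -[x]/(val (val (@to_set_type _ (trace I U) (to_set_type Ix) Ux))) kvalE.
Qed.
End KSheaf.

Section DsumVal.
Context (k : fieldType) (T : topologicalType) (A : finType).
Context (I : A -> set T) (n : A -> nat).
Notation G := (dsum (fun a => dsum_pow (n a) (k_sheaf k (I a)))).

Definition dsum_val (U : opens T) (s : G U) (a : A) (i : 'I_(n a)) : T -> k :=
  kval ((s : forall a, dsum_pow (n a) (k_sheaf k (I a)) U) a i).
Arguments dsum_val [U] s a i x.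

Lemma dsum_val_linear (U : opens T) (c : k) (s t : G U) a i x :
  dsum_val (c *: s + t) a i x = c * dsum_val s a i x + dsum_val t a i x.
Proof. exact: kval_linear. Qed.

Lemma dsum_val_res (U V : opens T) (VU : V `<=` U) (s : G U) a i x :
  V x -> dsum_val (res VU s) a i x = dsum_val s a i x.
Proof. exact: kval_res. Qed.

Lemma dsum_val_inj (U : opens T) (s t : G U) :
  (forall a i x, U x -> dsum_val s a i x = dsum_val t a i x) -> s = t.
Proof.
move=> st; apply/functional_extensionality_dep => a.
by apply/functional_extensionality_dep => i; apply: kval_inj; exact: st.
Qed.

Lemma dsum_val_mk (U : opens T) (f : forall a, 'I_(n a) -> T -> k) :
  (forall a i, exists s : k_sheaf k (I a) U, forall x, U x -> kval s x = f a i x) ->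
  exists s : G U, forall a i x, U x -> dsum_val s a i x = f a i x.
Proof.
move=> H; exists (fun a i => projT1 (cid (H a i))) => a i x Ux.
by rewrite /dsum_val; case: cid => /= s ->.
Qed.
End DsumVal.
Arguments dsum_val [k T A I n U] s a i x.

Lemma sum_linear_comb (k : fieldType) (V : lmodType k) (B : finType)
    (P : pred B) (a : k) (c c' : B -> k) (v : B -> V) :
  a *: (\sum_(b | P b) c b *: v b) + \sum_(b | P b) c' b *: v b =
  \sum_(b | P b) (a * c b + c' b) *: v b.
Proof.
rewrite scaler_sumr -big_split; apply: eq_bigr => b _ /=.
by rewrite scalerA scalerDl.
Qed.

(** * Direct sums of sheaves [k_I] from frames of germs *)

Section Framing.
Context (k : fieldType) (T : topologicalType) (F : sheaf k T).
Context (B : finType) (I : B -> set T) (e : B -> forall x, stalk F x).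

(* [e b] is the image of the section 1 of k_(I b) under a morphism to F. *)
Hypothesis e_out : forall b x, ~ I b x -> e b x = 0.
Hypothesis e_loc : forall b x, I b x -> is_local_section (e b) x.
Hypothesis e_free : forall x (c : B -> k),
  \sum_b c b *: e b x = 0 -> forall b, I b x -> c b = 0.
Hypothesis e_span : forall x (u : stalk F x), exists c : B -> k,
  u = \sum_b c b *: e b x.

Lemma frame_coord_uniq x (c c' : B -> k) :
  \sum_b c b *: e b x = \sum_b c' b *: e b x -> forall b, I b x -> c b = c' b.
Proof.
move=> E b Ib; apply/eqP; rewrite -subr_eq0; apply/eqP.
apply: (e_free (x := x) (c := fun b => c b - c' b)) => //.
rewrite (eq_bigr (fun b => c b *: e b x - c' b *: e b x)) => [|b' _].
  by rewrite sumrB E subrr.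
by rewrite scalerBl.
Qed.

Lemma frame_local_section x (c : B -> k) : (forall b, ~ I b x -> c b = 0) ->
  is_local_section (fun y => \sum_b c b *: e b y) x.
Proof.
move=> c0; apply: is_local_section_sum => b _.
have [Ib|nIb] := pselect (I b x).
  exact: is_local_sectionZ (e_loc Ib).
exists (opensT T), 0; split=> // y Ny; rewrite c0 // scale0r.
exact: germ0.
Qed.

(** [Q] says that [s] is the tuple of coordinates of [t] in the frame [e]. There is one summand per
    index: equal intervals are not grouped. *)
Theorem framing_iso :
  sheaf_iso F (dsum (fun b => dsum_pow 1 (k_sheaf k (I b)))).
Proof.
pose Q (U : opens T) (t : F U)
    (s : dsum (fun b => dsum_pow 1 (k_sheaf k (I b))) U) : Prop :=
  forall x (Ux : U x), germ Ux t = \sum_b dsum_val s b ord0 x *: e b x.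
apply: (sheaf_iso_of_rel (Q := Q)).
- move=> U a s t s' t' Qs Qt x Ux.
  rewrite germ_linear Qs Qt sum_linear_comb; apply: eq_bigr => b _.
  apply: (congr1 (fun c => c *: e b x)).
  exact: (esym (@dsum_val_linear _ _ _ _ (fun=> 1%N) U a s' t' b ord0 x)).
- move=> U t.
  have H x : exists c : B -> k, (forall b, ~ I b x -> c b = 0) /\
      forall Ux : U x, germ Ux t = \sum_b c b *: e b x.
    have [Ux|nUx] := pselect (U x); last by exists (fun=> 0); split.
    have [c cP] := e_span (germ Ux t).
    (* Bars missing [x] have [e b x = 0], so their coefficient is free; 0 is the value that a
       section of [k_(I b)] takes there. *)
    exists (fun b => if `[< I b x >] then c b else 0); split.
      by move=> b nIb; case: asboolP.
    move=> Ux'; rewrite (Prop_irrelevance Ux' Ux) cP; apply: eq_bigr => b _.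
    by case: asboolP => // nIb; rewrite e_out // !scaler0.
  have /choice[c cP] := H.
  (* The section [t] and the combination with coefficients frozen at [x] have the same germ at [x],
     hence at nearby [y], where freeness compares the coordinates on the bars through [y]. *)
  have cloc x : U x -> exists N : opens T, N x /\
      forall y, N y -> U y -> forall b, I b y -> c y b = c x b.
    move=> Ux; have [c0 cx] := cP x.
    have [N [s [Nx sN]]] := frame_local_section c0.
    have /germP[M [MU [MN [Mx E]]]] : germ Ux t = germ Nx s by rewrite cx sN.
    exists M; split=> // y My Uy; apply: frame_coord_uniq.
    have [_ /(_ Uy) <-] := cP y; rewrite -(sN _ (MN _ My)).
    by rewrite -(germ_res MU Uy My) E (germ_res MN (MN _ My)).
  have [|s sP] := @dsum_val_mk k T B I (fun=> 1%N) U (fun b _ x => c x b).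
    move=> b i; apply: kval_mk => x.
      by have [c0 _] := cP x; exact: c0.
    by move=> /cloc[N [Nx Nc]]; exists N; split=> // y Ny Uy; exact: Nc.
  exists s => x Ux; have [_ ->] := cP x; apply: eq_bigr => b _.
  by rewrite sP.
- move=> U s; have [|t tP] := @glue_germs _ _ F U
    (fun x => \sum_b dsum_val s b ord0 x *: e b x); last by exists t.
  move=> x Ux; apply: is_local_section_sum => b _.
  have [N [Nx Ns]] := kval_local
    ((s : forall b, dsum_pow 1 (k_sheaf k (I b)) U) b ord0) Ux.
  (* Near [x] the coordinate is constant on [I b], and [e b] vanishes elsewhere, so the coefficient
     may be frozen at its value in [x]. *)
  apply: (@is_local_section_near _ _ _ (fun y => dsum_val s b ord0 x *: e b y) _ x
    (opensI N U)) => //.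
    move=> y [Ny Uy]; have [Ib|nIb] := pselect (I b y); last first.
      by rewrite e_out // !scaler0.
    by congr (_ *: _); rewrite /dsum_val Ns.
  have [Ib|nIb] := pselect (I b x); first exact: is_local_sectionZ (e_loc Ib).
  exists (opensT T), 0; split=> // y Ny; rewrite /dsum_val kval_out // scale0r.
  exact: germ0.
- by move=> U s t s' Qs Qt; apply: sec_eq_germ => x Ux; rewrite Qs Qt.
- move=> U t s s' Qs Qs'; apply: dsum_val_inj => b i x Ux; rewrite (ord1 i).
  have [Ib|nIb] := pselect (I b x); last by rewrite /dsum_val !kval_out.
  apply: (frame_coord_uniq (c := fun b => dsum_val s b ord0 x)
    (c' := fun b => dsum_val s' b ord0 x) _ Ib).
  by rewrite -(Qs _ Ux) -(Qs' _ Ux).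
- move=> U V VU t s Qs x Vx; rewrite (germ_res VU (VU _ Vx) Vx) Qs.
  by apply: eq_bigr => b _; rewrite dsum_val_res.
Qed.
End Framing.

(** * Decomposition of zigzags of linear relations *)

Section LinearAlgebra.
Context (k : fieldType).

Lemma submod_sum (V : lmodType k) (S : submod V) (B : finType) (P : pred B)
    (c : B -> k) (x : B -> V) :
  (forall b, P b -> c b != 0 -> S (x b)) -> S (\sum_(b | P b) c b *: x b).
Proof.
move=> Sx; apply: (big_ind (fun v => S v)); first exact: submod0.
  by move=> u v Su Sv; rewrite -(scale1r u); exact: submodP.
move=> b Pb; have [->|cb] := eqVneq (c b) 0; first by rewrite scale0r; exact: submod0.
by rewrite -[_ *: _]addr0; apply: submodP; [exact: Sx|exact: submod0].
Qed.

Lemma sum_if_coef (V : lmodType k) (B : finType) (P Q : pred B)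
    (c : B -> k) (x : B -> V) :
  \sum_(b | P b && Q b) c b *: x b =
  \sum_(b | P b) (if Q b then c b else 0) *: x b.
Proof.
by rewrite big_mkcondr; apply: eq_bigr => b _; case: ifP; rewrite ?scale0r.
Qed.

(** Finite dimension in the form consumed by [adapted_extension]: a bound on free families, which
    makes a longest one exist. *)
Definition bounded_dim (V : lmodType k) : Prop :=
  exists r : nat, forall m (y : 'I_m -> V),
    (forall d : 'I_m -> k, \sum_i d i *: y i = 0 -> forall i, d i = 0) ->
    (m <= r)%N.

Lemma bounded_dim_inj (V : lmodType k) (r : nat) (f : {linear V -> 'rV[k]_r}) :
  injective f -> bounded_dim V.
Proof.
move=> finj; exists r => m y yfree.
pose A : 'M[k]_(m, r) := \matrix_i f (y i).
suff /eqP <- : row_free A by exact: rank_leq_col.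
rewrite -kermx_eq0; apply/eqP/row_matrixP => i; rewrite row0.
pose u := row i (kermx A).
have uA : u *m A = 0 by rewrite /u -row_mul mulmx_ker row0.
have u0 : forall j, u 0 j = 0.
  apply: yfree; apply: finj; rewrite linear0 linear_sum -[RHS]uA mulmx_sum_row.
  by apply: eq_bigr => j _; rewrite linearZ rowK.
by apply/rowP => j; rewrite -/u u0 mxE.
Qed.

Definition extended_sum (V : lmodType k) (B : finType) (P : pred B) (x : B -> V)
    (m : nat) (y : 'I_m -> V) (c : B -> k) (d : 'I_m -> k) : V :=
  \sum_(b | P b) c b *: x b + \sum_i d i *: y i.

(** [Y] need not be a subspace: it suffices that each vector of [S j] can be corrected, modulo the
    span of [x], into a vector of [S j] satisfying [Y]. A longest admissible family [y] spans, for
    otherwise a vector outside the span, taken in the smallest possible [S j], could be added. *)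
Lemma adapted_extension (V : lmodType k) (S : nat -> submod V) (n : nat)
    (B : finType) (P : pred B) (x : B -> V) (Y : V -> Prop) :
  bounded_dim V ->
  (forall i j v, (i <= j)%N -> S i v -> S j v) -> (forall v, S n v) ->
  (forall c, \sum_(b | P b) c b *: x b = 0 -> forall b, P b -> c b = 0) ->
  (forall j c, S j (\sum_(b | P b) c b *: x b) ->
     forall b, P b -> c b != 0 -> S j (x b)) ->
  (forall j v, S j v -> exists v' c,
     [/\ S j v', Y v' & v = v' + \sum_(b | P b) c b *: x b]) ->
  exists m (y : 'I_m -> V), [/\ forall i, Y (y i),
      forall c d, extended_sum P x y c d = 0 ->
        (forall b, P b -> c b = 0) /\ (forall i, d i = 0),
      forall j c d, S j (extended_sum P x y c d) ->
        (forall b, P b -> c b != 0 -> S j (x b)) /\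
        (forall i, d i != 0 -> S j (y i)) &
      forall v, exists c d, v = extended_sum P x y c d].
Proof.
move=> [r Vr] Smono Sn xfree xS xY.
pose good m (y : 'I_m -> V) :=
  [/\ forall i, Y (y i),
    forall c d, extended_sum P x y c d = 0 ->
      (forall b, P b -> c b = 0) /\ (forall i, d i = 0) &
    forall j c d, S j (extended_sum P x y c d) ->
        (forall b, P b -> c b != 0 -> S j (x b)) /\
        (forall i, d i != 0 -> S j (y i))].
have Q0 : exists m, `[< exists y, good m y >].
  exists 0%N; apply/asboolP; exists (fun=> 0).
  split=> [[]//|c d|j c d]; rewrite /extended_sum big_ord0 addr0.
    by move=> E; split=> [|[]//]; exact: xfree.
  by move=> E; split=> [|[]//]; exact: xS E.
have Qr m : `[< exists y, good m y >] -> (m <= r)%N.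
  move=> /asboolP[y [_ yfree _]]; apply: (Vr _ y) => d dy.
  have [|_ //] := yfree (fun=> 0) d.
  by rewrite /extended_sum dy addr0 big1 // => b _; rewrite scale0r.
case: (ex_maxnP Q0 Qr) => m /asboolP[y [yY yfree yS]] mmax.
exists m, y; split=> //; apply: contrapT => /existsNP[v0 v0n].
pose span v := exists c d, v = extended_sum P x y c d.
have spanP a u v : span u -> span v -> span (a *: u + v).
  move=> [c [d ->]] [c' [d' ->]].
  exists (fun b => a * c b + c' b), (fun i => a * d i + d' i).
  by rewrite /extended_sum scalerDr addrACA !sum_linear_comb.
have span0 : span 0.
  by exists (fun=> 0), (fun=> 0); rewrite /extended_sum !big1 ?addr0 // => b _;
    rewrite scale0r.
have spanZ a u : span u -> span (a *: u).
  by move=> su; rewrite -[_ *: _]addr0; apply: (spanP _ _ _).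
have spanx c : span (\sum_(b | P b) c b *: x b).
  exists c, (fun=> 0); rewrite /extended_sum [X in _ + X]big1 ?addr0 // => b _.
  by rewrite scale0r.
(* Minimality of [j] keeps the enlarged family adapted: every [S i] with [i < j] already lies in the
   span. *)
have ex_j : exists j, `[< exists v, S j v /\ ~ span v >].
  by exists n; apply/asboolP; exists v0.
case: (ex_minnP ex_j) => j /asboolP[v [Sv nv]] jmin.
have [v' [c0 [Sv' Yv' vE]]] := xY _ _ Sv.
have nv' : ~ span v'.
  move=> sv'; apply: nv; rewrite vE -[v']scale1r; exact: spanP.
pose y' (i : 'I_m.+1) := if unlift ord0 i is Some i' then y i' else v'.
have XE c d : extended_sum P x y' c d =
    d ord0 *: v' + extended_sum P x y c (fun i => d (lift ord0 i)).
  rewrite /extended_sum big_ord_recl /y' unlift_none addrCA; congr (_ + (_ + _)).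
  by apply: eq_bigr => i _; rewrite liftK.
suff : (m.+1 <= m)%N by rewrite ltnn.
apply: mmax; apply/asboolP; exists y'; split.
- by move=> i; rewrite /y'; case: unliftP.
- move=> c d; rewrite XE => E.
  have d0 : d ord0 = 0.
    apply/eqP; apply: contrapT => /negP d0; apply: nv'.
    rewrite -[v']scale1r -(mulVf d0) -scalerA; apply: (spanZ _ _).
    move/eqP: E; rewrite addr_eq0 => /eqP ->; rewrite -scaleN1r; apply: (spanZ _ _).
    by exists c, (fun i => d (lift ord0 i)).
  move: E; rewrite d0 scale0r add0r => /yfree[cE dE]; split=> // i.
  by case: (unliftP ord0 i) => [i'|] -> //.
- move=> i c d; rewrite XE => E.
  have [d0|d0] := eqVneq (d ord0) 0.
    move: E; rewrite d0 scale0r add0r => /yS[cE dE]; split=> // i'.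
    rewrite /y'; case: unliftP => [i''|] -> //; first exact: dE.
    by rewrite d0 eqxx.
  (* Otherwise the combination, being in [S i], would lie in the span, and so would [v'], whose
     coefficient is nonzero. *)
  have ji : (j <= i)%N.
    rewrite leqNgt; apply/negP => ij; apply: nv'.
    rewrite -[v']scale1r -(mulVf d0) -scalerA; apply: (spanZ _ _).
    rewrite -(addrK (extended_sum P x y c (fun i => d (lift ord0 i))) (_ *: v')).
    rewrite addrC -scaleN1r.
    apply: (spanP _ _ _); first by exists c, (fun i => d (lift ord0 i)).
    apply: contrapT => ns; have := jmin i; rewrite leqNgt ij => jm.
    have /jm // : `[< exists v, S i v /\ ~ span v >].
    by apply/asboolP; eexists; split; first exact: E.
  have Siv' := Smono _ _ _ ji Sv'.
  have : S i (extended_sum P x y c (fun i => d (lift ord0 i))).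
    rewrite -(addKr (d ord0 *: v') (extended_sum _ _ _ _ _)) -scaleNr.
    exact: submodP.
  move=> /yS[cE dE]; split=> // i'.
  by rewrite /y'; case: unliftP => [i''|] -> //; exact: dE.
Qed.

End LinearAlgebra.

(** * Barcodes and their extension by one space on the left *)

Section Barcodes.
Context (k : fieldType).

(** A subspace of the product of [V] and [W]; the graph of a map in either direction is an
    instance. *)
Record linear_rel (V W : lmodType k) := LinearRel {
  lrel :> V -> W -> Prop;
  lrel0 : lrel 0 0;
  lrelP : forall (a : k) u u' v v',
    lrel u v -> lrel u' v' -> lrel (a *: u + u') (a *: v + v') }.

Section Push.
Context (V W : lmodType k) (R : linear_rel V W) (S : submod V).

Fact push0 : exists2 v, S v & R v 0.
Proof. by exists 0; [exact: submod0|exact: lrel0]. Qed.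

Fact pushP (a : k) (w w' : W) : (exists2 v, S v & R v w) ->
  (exists2 v, S v & R v w') -> exists2 v, S v & R v (a *: w + w').
Proof.
move=> [v Sv Rv] [v' Sv' Rv']; exists (a *: v + v'); first exact: submodP.
exact: lrelP.
Qed.

Definition push : submod W := Submod push0 pushP.
End Push.

Definition full_submod (V : lmodType k) : submod V :=
  @Submod k V (fun=> True) I (fun _ _ _ _ _ => I).

Fact zero_submodP (V : lmodType k) (a : k) (u v : V) :
  u = 0 -> v = 0 -> a *: u + v = 0.
Proof. by move=> -> ->; rewrite scaler0 addr0. Qed.

Definition zero_submod (V : lmodType k) : submod V :=
  @Submod k V (fun v => v = 0) (erefl 0) (@zero_submodP V).

Lemma lrel_sum (V W : lmodType k) (R : linear_rel V W) (B : finType)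
    (P : pred B) (c : B -> k) (x : B -> V) (y : B -> W) :
  (forall b, P b -> R (x b) (y b)) ->
  R (\sum_(b | P b) c b *: x b) (\sum_(b | P b) c b *: y b).
Proof.
move=> Rxy; apply: (big_ind2 (fun u v => R u v)); first exact: lrel0.
  by move=> u u' v v' Ru Rv; rewrite -[u]scale1r -[u']scale1r; exact: lrelP.
move=> b /Rxy Rb; rewrite -[_ *: x b]addr0 -[_ *: y b]addr0.
by apply: lrelP => //; exact: lrel0.
Qed.

(* When [R i] is the graph of a linear map, in either direction, [bar_next] and
   [bar_prev] say that this map sends each [e b] to [e b] or to 0. *)
Record barcode (V : nat -> lmodType k) (R : forall i, linear_rel (V i) (V i.+1))
    (N : nat) (B : finType) (live : B -> nat -> bool)
    (e : B -> forall i, V i) : Prop := Barcode {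
  bar_nonempty : forall b, exists2 i, (i <= N)%N & live b i;
  bar_convex : forall b i j l,
    live b i -> live b j -> (i <= l <= j)%N -> live b l;
  bar_out : forall b i, ~~ live b i -> e b i = 0;
  bar_free : forall i c, (i <= N)%N ->
    \sum_(b | live b i) c b *: e b i = 0 -> forall b, live b i -> c b = 0;
  bar_span : forall i v, (i <= N)%N ->
    exists c, v = \sum_(b | live b i) c b *: e b i;
  bar_next : forall i b, (i < N)%N -> live b i ->
    (exists w, R i (e b i) w) -> R i (e b i) (e b i.+1);
  bar_prev : forall i b, (i < N)%N -> live b i.+1 ->
    (exists v, R i v (e b i.+1)) -> R i (e b i) (e b i.+1) }.

(** For a basis [x], this says that [S] is spanned by the basis vectors it contains. *)
Definition adapted (V : lmodType k) (S : submod V) (B : finType) (P : pred B)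
    (x : B -> V) : Prop :=
  forall c, S (\sum_(b | P b) c b *: x b) ->
    forall b, P b -> c b != 0 -> S (x b).

(** Lifts of the bars that reach [V 0] are completed by bars living at place 0 only. Conditions on a
    combination of lifts are tested on its image, where adaptedness separates the bars. *)
Lemma barcode_extend (V : nat -> lmodType k)
    (R : forall i, linear_rel (V i) (V i.+1)) (N n : nat)
    (S : nat -> submod (V 0)) (S' : nat -> submod (V 1))
    (B : finType) (live : B -> nat -> bool) (e : B -> forall i, V i.+1) :
  bounded_dim (V 0) ->
  (forall i j v, (i <= j)%N -> S i v -> S j v) -> (forall v, S n v) ->
  (forall j, (j <= n)%N -> S' j.+1 = push (R 0) (S j)) ->
  S' 0 = push (R 0) (zero_submod (V 0)) ->
  barcode (fun i => R i.+1) N live e ->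
  (forall j, adapted (S' j) (live^~ 0%N) (fun b => e b 0)) ->
  exists (B' : finType) (live' : B' -> nat -> bool) (e' : B' -> forall i, V i),
    barcode R N.+1 live' e' /\
    forall j, adapted (S j) (live'^~ 0%N) (fun b => e' b 0).
Proof.
move=> fdV Smono Sn S'S S'0 bc ad.
(* [M] selects the bars continued to [V 0]. A vector to which 0 is related is excluded: its bar
   stops and takes the value 0 on the left. *)
pose M2 b := `[< ~ R 0 0 (e b 0) >] && `[< exists v, R 0 v (e b 0) >].
pose M b := live b 0 && M2 b.
(* From [n] on the chain is the whole space, whereas [S'] is tied to [S] only up to [n]. *)
have Scap j : exists2 j', (j' <= n)%N & forall v, S j v = S j' v.
  have [jn|nj] := leqP j n; first by exists j.
  by exists n => // v; apply/propext; split=> _ //; exact: Smono (ltnW nj) (Sn v).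
(* The lift is taken in the smallest [S j] whose image contains [e b 0], so that membership of
   [e b 0] in the image of any [S j] passes to the lift. *)
have /choice[x xP] (b : B) : exists v, M b -> R 0 v (e b 0) /\
    forall j, push (R 0) (S j) (e b 0) -> S j v.
  have [/andP[_ /andP[_ /asboolP[v Rv]]]|_] := boolP (M b); last by exists 0.
  have ex : exists j, `[< push (R 0) (S j) (e b 0) >].
    by exists n; apply/asboolP; exists v.
  case: (ex_minnP ex) => j /asboolP[v' Sv' Rv'] jmin.
  exists v' => _; split=> // i Si; apply: Smono Sv'; apply: jmin.
  exact/asboolP.
have xR b : M b -> R 0 (x b) (e b 0) by move=> /xP[].
have Rsum c : R 0 (\sum_(b | M b) c b *: x b) (\sum_(b | M b) c b *: e b 0).
  exact: lrel_sum.
have eM c : \sum_(b | M b) c b *: e b 0 =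
    \sum_(b | live b 0) (if M2 b then c b else 0) *: e b 0.
  exact: sum_if_coef.
have xS j c : S j (\sum_(b | M b) c b *: x b) ->
    forall b, M b -> c b != 0 -> S j (x b).
  have [j' j'n jj'] := Scap j; rewrite jj' => Sx b Mb cb; rewrite jj'.
  have [_] := xP _ Mb; apply.
  have : S' j'.+1 (\sum_(b | M b) c b *: e b 0).
    by rewrite S'S //; exists (\sum_(b | M b) c b *: x b).
  rewrite eM => /ad /(_ b); have /andP[-> M2b] := Mb.
  by rewrite M2b S'S //; apply.
(* Here the bottom term of [S'] serves: a nontrivial relation between lifts would put some [e b 0]
   with [M b] in the image of 0. *)
have xfree c : \sum_(b | M b) c b *: x b = 0 -> forall b, M b -> c b = 0.
  move=> x0 b Mb; apply/eqP; apply: contrapT => /negP cb.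
  have : S' 0%N (\sum_(b | M b) c b *: e b 0).
    by rewrite S'0; exists 0 => //; rewrite -x0.
  rewrite eM => /ad /(_ b); have /andP[-> M2b] := Mb.
  rewrite M2b S'0 => /(_ isT cb)[_ -> R0].
  by have /andP[/asboolP] := M2b.
(* A new basis vector opens a bar confined to [V 0]. If it is related to anything, it must be
   related to 0, the value of that bar at the next place. *)
pose Y v := (exists w, R 0 v w) -> R 0 v 0.
have xY j v : S j v -> exists v' c,
     [/\ S j v', Y v' & v = v' + \sum_(b | M b) c b *: x b].
  have [j' j'n jj'] := Scap j; rewrite jj' => Sv.
  have [[w Rw]|nw] := pselect (exists w, R 0 v w); last first.
    exists v, (fun=> 0); rewrite jj' big1 ?addr0; last by move=> b _; rewrite scale0r.
    by split=> // /nw.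
  have [c wE] := bar_span bc w (leq0n N).
  exists (v - \sum_(b | M b) c b *: x b), c; rewrite jj' subrK.
  have inS b : live b 0 -> c b != 0 -> push (R 0) (S j') (e b 0).
    move=> lb cb; have : S' j'.+1 w by rewrite S'S //; exists v.
    by rewrite wE => /ad /(_ b lb cb); rewrite S'S.
  split=> //.
    rewrite addrC -scaleN1r; apply: submodP => //; apply: submod_sum => b Mb cb.
    by have [_] := xP _ Mb; apply; apply: inS => //; case/andP: Mb.
  move=> _.
  have : push (R 0) (zero_submod (V 0)) (w - \sum_(b | M b) c b *: e b 0).
    rewrite eM wE -sumrB.
    rewrite (eq_bigr (fun b => (if M2 b then 0 else c b) *: e b 0)); last first.
      by move=> b _; case: ifP => _; rewrite ?scale0r ?subrr ?subr0.
    apply: submod_sum => b lb; case: ifP => [_|nM cb]; first by rewrite eqxx.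
    have [v' Sv' Rv'] := inS b lb cb.
    exists 0 => //; apply: contrapT => nR; move/negP: nM; apply.
    by apply/andP; split; apply/asboolP => //; exists v'.
  move=> [_ -> R0].
  have := lrelP (-1) R0 (lrelP (-1) (Rsum c) Rw).
  by rewrite scaler0 add0r !scaleN1r [- _ + v]addrC [- _ + w]addrC addNr.
have [m [y [yY yfree yS yspan]]] :=
  adapted_extension fdV Smono Sn xfree xS xY.
pose live' (b : B + 'I_m) i := match b, i with
  | inl b, 0 => M b | inl b, i.+1 => live b i | inr _, i => i == 0%N end.
pose e' (b : B + 'I_m) i : V i := match i with
  | 0 => match b with inl b => if M b then x b else 0 | inr j => y j end
  | i.+1 => match b with inl b => e b i | inr _ => 0 end end.
have sum0 c : \sum_(b | live' b 0%N) c b *: e' b 0%N =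
    extended_sum M x y (fun b => c (inl b)) (fun i => c (inr i)).
  rewrite big_sumType /=; congr (_ + _).
  by apply: eq_bigr => b Mb; rewrite Mb.
have sumS i c : \sum_(b | live' b i.+1) c b *: e' b i.+1 =
    \sum_(b | live b i) c (inl b) *: e b i.
  by rewrite big_sumType /= big_pred0_eq addr0.
exists (B + 'I_m)%type, live', e'; split; first split.
- case=> [b|j]; last by exists 0%N.
  by have [i iN lb] := bar_nonempty bc b; exists i.+1.
- move=> [b|j] [|i] [|j'] [|l] //=; rewrite ?andbF //.
  + by move=> /andP[l0 _] lj; exact: (bar_convex bc l0 lj).
  + exact: (bar_convex bc).
- move=> [b|j] [|i] //=; last exact: (bar_out bc).
  by move=> /negbTE ->.
- move=> [|i] c iN; first rewrite sum0 => /yfree[cM cy] [b|j] //=.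
  + exact: cM.
  + by rewrite sumS => /(bar_free bc iN) c0 [b|//]; exact: c0.
- move=> [|i] v iN.
    have [c [d ->]] := yspan v.
    by exists (fun b => match b with inl b => c b | inr j => d j end); rewrite sum0.
  have [c ->] := bar_span bc v iN.
  by exists (fun b => match b with inl b => c b | inr j => 0 end); rewrite sumS.
- move=> [|i] [b|j] iN //=.
  + by move=> Mb _; rewrite Mb; exact: xR.
  + by move=> _; exact: yY.
  + exact: (bar_next bc iN).
- move=> [|i] [b|j] iN //=; last exact: (bar_prev bc iN).
  move=> lb Rb; case: ifPn => [|nM]; first exact: xR.
  apply: contrapT => nR; move/negP: nM; apply.
  by rewrite /M lb /=; apply/andP; split; exact/asboolP.
- move=> j c; rewrite sum0 => /yS[cM cy] [b|i] /=.
    by move=> Mb; rewrite Mb; exact: cM.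
  by move=> _; exact: cy.
Qed.

(** For a single space a barcode is a basis adapted to the flag, obtained by extending the empty
    family. *)
Lemma barcode_start (V : nat -> lmodType k)
    (R : forall i, linear_rel (V i) (V i.+1)) (n : nat) (S : nat -> submod (V 0)) :
  bounded_dim (V 0) ->
  (forall i j v, (i <= j)%N -> S i v -> S j v) -> (forall v, S n v) ->
  exists (B : finType) (live : B -> nat -> bool) (e : B -> forall i, V i),
    barcode R 0 live e /\
    forall j, adapted (S j) (live^~ 0%N) (fun b => e b 0).
Proof.
move=> fdV Smono Sn.
have [| |j v Sv|m [y [_ yfree yS yspan]]] := @adapted_extension k (V 0) S n
    'I_0 predT (fun=> 0) (fun=> True) fdV Smono Sn.
- by move=> c _ [].
- by move=> j c _ [].
- by exists v, (fun=> 0); rewrite big_ord0 addr0.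
pose live (b : 'I_m) i := i == 0%N.
pose e (b : 'I_m) i : V i := match i with 0 => y b | i.+1 => 0 end.
have sum0 (c0 : 'I_0 -> k) c : extended_sum predT (fun=> 0) y c0 c =
    \sum_(b | live b 0%N) c b *: e b 0%N.
  by rewrite /extended_sum big_ord0 add0r.
exists 'I_m, live, e; split; first split=> //.
- by move=> b; exists 0%N.
- by move=> b i j l /eqP -> /eqP ->; rewrite leqn0 => /andP[_].
- by move=> b [].
- by case=> // c _; rewrite -(sum0 (fun=> 0)) => /yfree[_ c0] b _; exact: c0.
- by case=> // v _; have [c0 [c ->]] := yspan v; exists c; rewrite sum0.
- by move=> j c; rewrite -(sum0 (fun=> 0)) => /yS[_ yc] b _; exact: yc.
Qed.

(* The chain S of subspaces of V 0 is pushed to V 1 before the induction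
   hypothesis is used, so that the bars reaching V 1 are adapted to the births
   on their left and can be continued to V 0 without being modified. *)
Theorem barcode_exists (N : nat) (V : nat -> lmodType k)
    (R : forall i, linear_rel (V i) (V i.+1)) (n : nat) (S : nat -> submod (V 0)) :
  (forall i, bounded_dim (V i)) ->
  (forall i j v, (i <= j)%N -> S i v -> S j v) -> (forall v, S n v) ->
  exists (B : finType) (live : B -> nat -> bool) (e : B -> forall i, V i),
    barcode R N live e /\
    forall j, adapted (S j) (live^~ 0%N) (fun b => e b 0).
Proof.
elim: N V R n S => [|N IHN] V R n S fdV Smono Sn.
  exact: barcode_start (fdV 0) Smono Sn.
(* The pushed flag gains a term at each end: the image of 0 below, and the whole space above the
   image of [R 0]. Hence the length [n.+2]. *)
pose S' j : submod (V 1%N) := match j with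
  | 0 => push (R 0) (zero_submod (V 0))
  | j.+1 => if (j <= n)%N then push (R 0) (S j) else full_submod _ end.
have [|j|B [live [e [bc ad]]]] :=
    IHN (fun i => V i.+1) (fun i => R i.+1) n.+2 S' (fun i => fdV i.+1).
- move=> [|i] [|j] v //=.
    case: ifP => // _ _ [_ -> R0]; exists 0 => //; exact: submod0.
  rewrite ltnS => ij; case: (leqP j n) => // jn; rewrite (leq_trans ij jn).
  by move=> [u Su Ru]; exists u => //; exact: Smono Su.
- by rewrite /S' ltnn.
apply: (barcode_extend (n := n) (S' := S')) bc ad => //.
by move=> j jn; rewrite /S' jn.
Qed.
End Barcodes.

(** * Sheaves on a line cut into cells *)

Section Line.
Context (R : realType) (k : fieldType) (F : sheaf k R).

Definition opensU (U V : opens R) : opens R :=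
  Opens (openU (opens_open U) (opens_open V)).

Lemma is_intervalI (A B : set R) :
  is_interval A -> is_interval B -> is_interval (A `&` B).
Proof.
move=> iA iB x y [Ax Bx] [Ay By] z xzy.
by split; [exact: (iA x y)|exact: (iB x y)].
Qed.

Lemma is_intervalU (A B : set R) : is_interval A -> is_interval B ->
  (A `&` B !=set0) -> is_interval (A `|` B).
Proof.
move=> iA iB [c [Ac Bc]] x y ABx ABy z /andP[xz zy].
have [zc|/ltW cz] := leP z c.
  case: ABx => [Ax|Bx]; [left; apply: (iA x c)|right; apply: (iB x c)] => //;
  by rewrite xz.
by case: ABy => [Ay|By]; [left; apply: (iA c y)|right; apply: (iB c y)] => //;
  rewrite cz.
Qed.

Lemma open_interval_nbhs (U : opens R) (x : R) : U x ->
  exists B : opens R, [/\ B x, B `<=` U & is_interval B].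
Proof.
move=> Ux; have /nbhs_ballP[e e0 eU] := open_nbhs_nbhs (conj (opens_open U) Ux).
exists (Opens (@ball_open R R x e)); split=> //=; first exact: ballxx.
by rewrite ball_itv; exact: interval_is_interval.
Qed.

(* F behaves on C like a constant sheaf on an interval. *)
Record propagates (C : opens R) : Prop := Propagates {
  germ_extends : forall x (Cx : C x) (u : stalk F x),
    exists s : F C, germ Cx s = u;
  germ_vanishes : forall (U : opens R) (s : F U), U `<=` C -> is_interval U ->
    forall x y (Ux : U x) (Uy : U y), germ Ux s = 0 -> germ Uy s = 0 }.

Lemma germB (x : R) (U : opens R) (Ux : U x) (s t : F U) :
  germ Ux (s - t) = germ Ux s - germ Ux t.
Proof. exact: (linearB (germ_lin F Ux)). Qed.

Lemma germ_eq_propagates (C : opens R) : propagates C ->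
  forall (U V W : opens R) (s : F U) (t : F V), is_interval W -> W `<=` C ->
  W `<=` U -> W `<=` V ->
  forall x y (Ux : U x) (Vx : V x) (Uy : U y) (Vy : V y), W x -> W y ->
  germ Ux s = germ Vx t -> germ Uy s = germ Vy t.
Proof.
move=> pC U V W s t iW WC WU WV x y Ux Vx Uy Vy Wx Wy E.
apply/eqP; rewrite -subr_eq0; apply/eqP.
rewrite -(germ_res WU _ Wy) -(germ_res WV _ Wy) -germB.
apply: (germ_vanishes pC WC iW (Ux := Wx)).
by rewrite germB (germ_res WU Ux) (germ_res WV Vx) E subrr.
Qed.

(** Parallel transport: extend a germ to [C] and take the germ at [y]. Propagation of zeros makes
    the result independent of the extension and, exchanging [x] and [y], injective. *)
Lemma propagates_transport (C : opens R) (x y : R) : is_interval C ->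
  propagates C -> C x -> C y ->
  exists tau : {linear stalk F x -> stalk F y},
    [/\ injective tau, forall v, exists u, v = tau u &
      forall (U : opens R) (s : F U) (Ux : U x) (Uy : U y),
        U `<=` C -> is_interval U -> germ Uy s = tau (germ Ux s)].
Proof.
move=> iC pC Cx Cy.
pose f u : F C := projT1 (cid (germ_extends pC Cx u)).
have fP u : germ Cx (f u) = u := projT2 (cid (germ_extends pC Cx u)).
have CC : C `<=` C by [].
have eqC (s t : F C) : germ Cx s = germ Cx t -> germ Cy s = germ Cy t.
  exact: (germ_eq_propagates pC iC CC CC CC).
have eqC' (s t : F C) : germ Cy s = germ Cy t -> germ Cx s = germ Cx t.
  exact: (germ_eq_propagates pC iC CC CC CC).
have taulin : linear (fun u => germ Cy (f u)).
  by move=> a u v; rewrite -germ_linear; apply: eqC; rewrite germ_linear !fP.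
exists (mk_linear taulin); split.
- by move=> u v /= /eqC'; rewrite !fP.
- move=> v; have [s <-] := germ_extends pC Cy v.
  by exists (germ Cx s) => /=; apply: eqC; rewrite fP.
- move=> U s Ux Uy UC iU /=.
  have UU : U `<=` U by [].
  by apply: (germ_eq_propagates pC iU UC UU UC (Ux := Ux) (Vx := Cx)) => //; rewrite fP.
Qed.

(** A section near [x] and the extension to [C] of one of its germs in [C] agree on the interval
    common to both domains, so they glue. For an endpoint [x] of a cell, this spreads a germ over
    the whole cell. *)
Lemma germ_extend_into (C : opens R) (x : R) (u : stalk F x) :
  is_interval C -> propagates C ->
  (forall B : opens R, B x -> B `&` C !=set0) ->
  exists (D : opens R) (t : F D) (Dx : D x),
    [/\ is_interval D, C `<=` D & germ Dx t = u].
Proof.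
move=> iC pC xC; have [U [Ux [s sU]]] := stalkP u.
have [B [Bx BU iB]] := open_interval_nbhs Ux.
have [y [By Cy]] := xC _ Bx.
pose sB := res BU s.
have [s2 s2E] := germ_extends pC Cy (germ By sB).
have agree z (Bz : B z) (Cz : C z) : germ Bz sB = germ Cz s2.
  apply: (germ_eq_propagates pC (W := opensI B C) _ _ _ _
    (x := y) (Ux := By) (Vx := Cy)) => //.
  - exact: is_intervalI.
  - exact: opensIr.
  - exact: opensIl.
  - exact: opensIr.
have gP z : exists g : stalk F z,
    (forall Bz : B z, germ Bz sB = g) /\ (forall Cz : C z, germ Cz s2 = g).
  have [Bz|nB] := pselect (B z).
    exists (germ Bz sB); split=> [Bz'|Cz]; first exact: germ_irr.
    by rewrite -agree.
  have [Cz|nC] := pselect (C z); last by exists 0; split.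
  by exists (germ Cz s2); split=> // Cz'; exact: germ_irr.
pose g z := projT1 (cid (gP z)).
have gB z (Bz : B z) : germ Bz sB = g z := (projT2 (cid (gP z))).1 Bz.
have gC z (Cz : C z) : germ Cz s2 = g z := (projT2 (cid (gP z))).2 Cz.
have [|t tP] := @glue_germs _ _ F (opensU B C) g.
  by move=> z [Bz|Cz]; [exists B, sB|exists C, s2].
have Dx : opensU B C x by left.
exists (opensU B C), t, Dx; split.
- by apply: is_intervalU => //; exists y.
- by move=> z; right.
- by rewrite tP -(gB _ Bx) (germ_res BU Ux) sU.
Qed.

(** Over a disconnected [U] the germs at [x] and [y] would be unrelated. If [x] is an endpoint of a
    cell along which [F] propagates and [y] lies in it, this is the graph of the generization map
    between the stalks. *)
Definition joined (x y : R) (u : stalk F x) (v : stalk F y) : Prop :=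
  exists (U : opens R) (s : F U) (Ux : U x) (Uy : U y),
    [/\ is_interval U, germ Ux s = u & germ Uy s = v].

Fact joined0 (x y : R) : joined (0 : stalk F x) (0 : stalk F y).
Proof.
exists (opensT R), 0, I, I; split; first by [].
  exact: germ0.
exact: germ0.
Qed.

Fact joinedP (x y : R) (a : k) (u u' : stalk F x) (v v' : stalk F y) :
  joined u v -> joined u' v' -> joined (a *: u + u') (a *: v + v').
Proof.
move=> [U [s [Ux [Uy [iU <- <-]]]]] [U' [s' [Ux' [Uy' [iU' <- <-]]]]].
have Ix : opensI U U' x by [].
have Iy : opensI U U' y by [].
exists (opensI U U'),
  (a *: res (@opensIl _ U U') s + res (@opensIr _ U U') s'), Ix, Iy.
split; first exact: is_intervalI.
- by rewrite germ_linear (germ_res _ Ux Ix) (germ_res _ Ux' Ix).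
- by rewrite germ_linear (germ_res _ Uy Iy) (germ_res _ Uy' Iy).
Qed.

Definition joined_rel (x y : R) : linear_rel (stalk F x) (stalk F y) :=
  LinearRel (@joined0 x y) (@joinedP x y).

(* The odd cells are points, the even cells are the open intervals between
   them. *)
Record cells (N : nat) (cell : R -> nat) (p : nat -> R) (C : nat -> opens R) : Prop :=
Cells {
  cells_even : ~~ odd N;
  cell_le : forall x, (cell x <= N)%N;
  cell_pt : forall i, (i <= N)%N -> cell (p i) = i;
  cell_mono : forall x y, x <= y -> (cell x <= cell y)%N;
  cell_odd : forall x y, odd (cell x) -> cell x = cell y -> x = y;
  cell_open : forall i, ~~ odd i -> forall x, C i x <-> cell x = i;
  cell_propagates : forall i, ~~ odd i -> propagates (C i) }.

Section Cells.
Context (N : nat) (cell : R -> nat) (p : nat -> R) (C : nat -> opens R).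
Hypothesis cN : cells N cell p C.

Lemma cell_between x y z : x <= z <= y -> cell x = cell y -> cell z = cell x.
Proof.
move=> /andP[xz zy] xy; apply/eqP; rewrite eqn_leq (cell_mono cN xz) andbT xy.
exact: (cell_mono cN zy).
Qed.

Lemma cell_interval i : ~~ odd i -> is_interval (C i).
Proof.
move=> ei x y /(cell_open cN ei) Cx /(cell_open cN ei) Cy z xzy.
by apply/(cell_open cN ei); rewrite (cell_between xzy) ?Cx.
Qed.

Lemma pt_lt i : (i < N)%N -> p i < p i.+1.
Proof.
move=> iN; rewrite ltNge; apply/negP => /(cell_mono cN).
by rewrite !(cell_pt cN) ?ltnn // ltnW.
Qed.

Lemma cell_right i y : odd i -> (i < N)%N -> p i < y <= p i.+1 -> cell y = i.+1.
Proof.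
move=> oi iN /andP[py yp].
have := cell_mono cN yp; rewrite (cell_pt cN iN) => h1.
have := cell_mono cN (ltW py); rewrite (cell_pt cN (ltnW iN)) => h2.
apply/eqP; rewrite eqn_leq h1 ltn_neqAle h2 andbT; apply/eqP => E.
have := @cell_odd _ _ _ _ cN (p i) y; rewrite (cell_pt cN (ltnW iN)) => /(_ oi E) H.
by rewrite H ltxx in py.
Qed.

Lemma cell_left i y : odd i.+1 -> (i < N)%N -> p i <= y < p i.+1 -> cell y = i.
Proof.
move=> oi iN /andP[py yp].
have := cell_mono cN py; rewrite (cell_pt cN (ltnW iN)) => h1.
have := cell_mono cN (ltW yp); rewrite (cell_pt cN iN) => h2.
apply/eqP; rewrite eqn_leq h1 andbT -ltnS ltn_neqAle h2 andbT; apply/eqP => E.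
have := @cell_odd _ _ _ _ cN (p i.+1) y; rewrite (cell_pt cN iN) => /(_ oi (esym E)) H.
by rewrite H ltxx in yp.
Qed.

Lemma near_right_cell i (B : opens R) : odd i -> (i < N)%N -> B (p i) ->
  B `&` C i.+1 !=set0.
Proof.
move=> oi iN; move=> /(fun h => open_nbhs_nbhs (conj (opens_open B) h)).
move=> /nbhs_ballP[e /= e0 eB].
have plt := pt_lt iN.
have [d /andP[d0 dm]] : exists d, 0 < d < Num.min e (p i.+1 - p i).
  exists (Num.min e (p i.+1 - p i) / 2).
  have m0 : 0 < Num.min e (p i.+1 - p i) by rewrite lt_min e0 subr_gt0.
  by rewrite divr_gt0 // ltr_pdivrMr // ltr_pMr // ltr1n.
move: dm; rewrite lt_min => /andP[de dp].
exists (p i + d); split.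
  by apply: eB; rewrite /ball /= opprD addrA subrr sub0r normrN gtr0_norm.
apply/(cell_open cN); first by rewrite /= negbK.
apply: cell_right => //; rewrite ltrDl d0 /= -lerBrDl; exact: ltW.
Qed.

Lemma near_left_cell i (B : opens R) : odd i.+1 -> (i < N)%N -> B (p i.+1) ->
  B `&` C i !=set0.
Proof.
move=> oi iN; move=> /(fun h => open_nbhs_nbhs (conj (opens_open B) h)).
move=> /nbhs_ballP[e /= e0 eB].
have plt := pt_lt iN.
have [d /andP[d0 dm]] : exists d, 0 < d < Num.min e (p i.+1 - p i).
  exists (Num.min e (p i.+1 - p i) / 2).
  have m0 : 0 < Num.min e (p i.+1 - p i) by rewrite lt_min e0 subr_gt0.
  by rewrite divr_gt0 // ltr_pdivrMr // ltr_pMr // ltr1n.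
move: dm; rewrite lt_min => /andP[de dp].
exists (p i.+1 - d); split.
  by apply: eB; rewrite /ball /= opprB addrC subrK gtr0_norm.
apply/(cell_open cN) => //.
apply: cell_left => //; rewrite ltrBlDr ltrDl d0 andbT lerBrDr -lerBrDl.
exact: ltW.
Qed.

End Cells.
End Line.

(** * From barcodes on the cells to interval decompositions *)

Section CellsDecomposition.
Context (R : realType) (k : fieldType) (F : sheaf k R).
Context (N : nat) (cell : R -> nat) (p : nat -> R) (C : nat -> opens R).
Hypothesis cN : cells F N cell p C.

(** Vacuous for odd cells: these are single points, where a section over any neighbourhood may be
    used. *)
Definition in_cell (i : nat) (U : opens R) : Prop :=
  ~~ odd i -> U `<=` C i /\ is_interval U.

Lemma cell_transport i x : cell x = i -> (i <= N)%N ->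
  exists tau : {linear stalk F (p i) -> stalk F x},
    [/\ injective tau, forall v, exists u, v = tau u &
      forall (U : opens R) (s : F U) (Up : U (p i)) (Ux : U x),
        in_cell i U -> germ Ux s = tau (germ Up s)].
Proof.
move=> xi iN; have [oi|ei] := boolP (odd i).
  have px : p i = x by apply: (cell_odd cN); rewrite (cell_pt cN iN).
  move: xi; case: x / px => _.
  have idlin : linear (fun u : stalk F (p i) => u) by [].
  exists (mk_linear idlin); split=> //; first by move=> v; exists v.
  by move=> U s Up Ux _; exact: germ_irr.
have Cp : C i (p i) by apply/(cell_open cN ei); rewrite (cell_pt cN iN).
have Cx : C i x by apply/(cell_open cN ei).
have [tau [ti ts tP]] := propagates_transport (cell_interval cN ei)
  (cell_propagates cN ei) Cp Cx.
by exists tau; split=> // U s Up Ux /(_ ei)[UC iU]; exact: tP.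
Qed.

Lemma stalk_joined_right i (u : stalk F (p i)) : odd i -> (i < N)%N ->
  exists w, joined_rel F (p i) (p i.+1) u w.
Proof.
move=> oi iN; have ei : ~~ odd i.+1 by rewrite /= negbK.
have [D [t [Dp [iD CD <-]]]] := germ_extend_into u (cell_interval cN ei)
  (cell_propagates cN ei) (fun B => @near_right_cell _ _ _ _ _ _ _ cN i B oi iN).
have Dp' : D (p i.+1) by apply/CD/(cell_open cN ei); rewrite (cell_pt cN).
by exists (germ Dp' t), D, t, Dp, Dp'.
Qed.

Lemma stalk_joined_left i (u : stalk F (p i.+1)) : odd i.+1 -> (i < N)%N ->
  exists v, joined_rel F (p i) (p i.+1) v u.
Proof.
move=> oi iN; have ei : ~~ odd i by [].
have [D [t [Dp [iD CD <-]]]] := germ_extend_into u (cell_interval cN ei)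
  (cell_propagates cN ei) (fun B => @near_left_cell _ _ _ _ _ _ _ cN i B oi iN).
have Dp' : D (p i) by apply/CD/(cell_open cN ei); rewrite (cell_pt cN) // ltnW.
by exists (germ Dp' t), D, t, Dp', Dp.
Qed.

Hypothesis F_bounded : forall x, bounded_dim (stalk F x : lmodType k).

(** A bar [b] spreads to the field [f b] by transport from [p i] over the [i]-th cell. Freeness and
    span then come cell by cell from the barcode; the delicate point is that [f b] is a local
    section at a cut point. *)
Theorem cells_decomposition :
  exists (A : finType) (I : A -> set R) (n : A -> nat),
    interval_decomposition F I n.
Proof.
(* The initial flag is trivial: nothing is born to the left of the first cell. *)
have [//|//|B [live [e [bc _]]]] := @barcode_exists k N
  (fun i => stalk F (p i) : lmodType k) (fun i => joined_rel F (p i) (p i.+1))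
  0 (fun=> full_submod _) (fun i => F_bounded (p i)).
pose tau x := projT1 (cid (cell_transport (erefl (cell x)) (cell_le cN x))).
have tauP x : [/\ injective (tau x), forall v, exists u, v = tau x u &
      forall (U : opens R) (s : F U) (Up : U (p (cell x))) (Ux : U x),
        in_cell (cell x) U -> germ Ux s = tau x (germ Up s)].
  exact: (projT2 (cid (cell_transport _ _))).
pose f b x : stalk F x := tau x (e b (cell x)).
have fP b x i (U : opens R) (s : F U) (Up : U (p i)) (Ux : U x) : cell x = i ->
    in_cell i U -> germ Up s = e b i -> germ Ux s = f b x.
  move=> xi; case: i / xi Up => Up UC E; have [_ _ ->] := tauP x.
    by rewrite E.
  exact: UC.
pose I b : set R := [set x | live b (cell x)].
have live_sum x (c : B -> k) :
    \sum_b c b *: f b x = tau x (\sum_(b | live b (cell x)) c b *: e b (cell x)).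
  rewrite linear_sum [RHS]big_mkcond; apply: eq_bigr => b _.
  case: ifPn => lb; first by rewrite linearZ.
  by rewrite /f (bar_out bc lb) linear0 scaler0.
exists B, I, (fun=> 1%N); split=> //.
- move=> b x y Ix Iy z /andP[xz zy]; apply: (bar_convex bc Ix Iy).
  by rewrite (cell_mono cN xz) (cell_mono cN zy).
- move=> b; have [i iN lb] := bar_nonempty bc b.
  by exists (p i); rewrite /I /= (cell_pt cN iN).
apply: (framing_iso (e := f)).
- by move=> b x /negP lb; rewrite /f (bar_out bc lb) linear0.
- move=> b x; rewrite /I /=; have [i xi] : exists i, cell x = i by exists (cell x).
  rewrite xi => lb; have iN : (i <= N)%N by rewrite -xi; exact: (cell_le cN).
  have [oi|ei] := boolP (odd i); last first.
    have Cp : C i (p i) by apply/(cell_open cN ei); rewrite (cell_pt cN iN).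
    have [s sE] := germ_extends (cell_propagates cN ei) Cp (e b i).
    exists (C i), s; split; first exact/(cell_open cN ei).
    move=> y Cy; apply: (fP b y i (C i) s Cp Cy _ _ sE).
      exact/(cell_open cN ei).
    by split=> //; exact: (cell_interval cN).
  (* [N] is even, so a point cell is never the last one. *)
  have iN' : (i < N)%N.
    rewrite ltn_neqAle iN andbT; apply/eqP => iE.
    by have := cells_even cN; rewrite -iE oi.
  have px : p i = x by apply: (cell_odd cN); rewrite (cell_pt cN iN) // xi.
  move: xi; case: x / px => xi.
  (* No distinction is made on whether [b] continues to the neighbouring cells: where it stops,
     [e b] is 0 and the joining section has a zero germ, as the frame requires. *)
  have [U [s [Up [Uq [iU sp sq]]]]] :=
    bar_next bc iN' lb (stalk_joined_right (e b i) oi iN').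
  case: i xi lb iN oi iN' U s Up Uq iU sp sq =>
    [//|j] xi lb iN oi iN' U s Up Uq iU sp sq.
  have [U' [s' [Up' [Uq' [iU' sp' sq']]]]] :=
    bar_prev bc iN lb (stalk_joined_left (e b j.+1) oi iN).
  have /germP[W [WU [WU' [Wp E]]]] : germ Up s = germ Uq' s' by rewrite sp sq'.
  (* This window meets only the point [p j.+1] and the two cells adjacent to it. *)
  have op : open `]p j, p j.+2[%classic by exact: interval_open.
  exists (opensI W (Opens op)), (res (@opensIl _ W (Opens op)) (res WU s)).
  split; first by split=> //=; rewrite in_itv /= !(pt_lt cN).
  move=> y Wy; have [Wy1 ywin] := Wy; rewrite (germ_res _ Wy1 Wy).
  move: (ywin); rewrite /= in_itv /= => /andP[jy yj].
  have [yp|py|yp] := ltgtP y (p j.+1).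
  + have Cy : cell y = j by apply: (cell_left cN oi iN); rewrite (ltW jy).
    have ej : ~~ odd j by [].
    have UCI : opensI U' (C j) `<=` U' := @opensIl _ _ _.
    have Vp : opensI U' (C j) (p j).
      by split=> //; apply/(cell_open cN ej); rewrite (cell_pt cN) // ltnW.
    have Vy : opensI U' (C j) y.
      by split; [exact: (WU' _ Wy1)|apply/(cell_open cN ej)].
    rewrite E (germ_res WU' (WU' _ Wy1)) -(germ_res UCI _ Vy).
    apply: (fP b y j _ _ Vp Vy Cy); last by rewrite (germ_res _ Up').
    move=> _; split; first exact: opensIr.
    by apply: is_intervalI => //; exact: (cell_interval cN).
  + have Cy : cell y = j.+2 by apply: (cell_right cN oi iN'); rewrite py ltW.
    have ej : ~~ odd j.+2 by rewrite /= negbK.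
    have UCI : opensI U (C j.+2) `<=` U := @opensIl _ _ _.
    have Vp : opensI U (C j.+2) (p j.+2).
      by split=> //; apply/(cell_open cN ej); rewrite (cell_pt cN).
    have Vy : opensI U (C j.+2) y.
      by split; [exact: (WU _ Wy1)|apply/(cell_open cN ej)].
    rewrite (germ_res WU (WU _ Wy1)) -(germ_res UCI _ Vy).
    apply: (fP b y _ _ _ Vp Vy Cy); last by rewrite (germ_res _ Uq).
    move=> _; split; first exact: opensIr.
    by apply: is_intervalI => //; exact: (cell_interval cN).
  + have Uy : U y := WU _ Wy1.
    rewrite (germ_res WU Uy).
    apply: (fP b y j.+1 U s Up Uy); first by rewrite yp.
      by rewrite /in_cell oi.
    exact: sp.
- move=> x c; rewrite live_sum => E b Ib.
  have [ti _ _] := tauP x.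
  apply: (bar_free bc (cell_le cN x)) Ib.
  by apply: ti; rewrite E linear0.
- move=> x u; have [_ ts _] := tauP x; have [v ->] := ts u.
  have [c ->] := bar_span bc v (cell_le cN x).
  by exists c; rewrite live_sum.
Qed.
End CellsDecomposition.

(** * Cells of a constructible sheaf *)

Section Stratum.
Context (k : fieldType) (T : topologicalType) (F : sheaf k T) (S : set T).
Notation X := (set_type S : topologicalType).

Definition restr_val (W : opens X) (s : restriction F S W) :
  dprod (fun x : set_type (opens_set W) => stalk F (val (val x))) := fun_val s.

Lemma restr_valP (W : opens X) (a : k) (s t : restriction F S W) x :
  restr_val (a *: s + t) x = a *: restr_val s x + restr_val t x.
Proof. exact: (congr1 (fun f : dprod _ => f x) (submod_val_linear a s t)). Qed.

Lemma restr_val_local (W : opens X) (s : restriction F S W) :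
  locally_section (restr_val s).
Proof. exact: (submod_in (s : submod_type _)). Qed.

Lemma restr_val_inj (W : opens X) : injective (@restr_val W).
Proof. exact: fun_val_inj. Qed.

Lemma restr_val_res (U W : opens X) (WU : W `<=` U) (s : restriction F S U) x :
  restr_val (res WU s) x = restr_val s (incl_set WU x).
Proof. by []. Qed.

Definition stratum_point (W : opens X) (x : T) (Sx : S x)
    (Wx : W (to_set_type Sx)) : set_type (opens_set W) := to_set_type Wx.

Lemma restr_val_irr (W : opens X) (s : restriction F S W) (x : T)
    (p p' : x \in S) (q : exist _ x p \in opens_set W)
    (q' : exist _ x p' \in opens_set W) :
  restr_val s (exist _ (exist _ x p) q) = restr_val s (exist _ (exist _ x p') q').
Proof.
move: q'; rewrite (bool_irrelevance p' p) => q'.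
by rewrite (bool_irrelevance q' q).
Qed.

(* [g u] is the image of the constant section u. *)
Lemma stratum_frame : constant_of_finite_rank (restriction F S) ->
  exists r (g : 'rV[k]_r -> forall x, stalk F x),
  [/\ forall x a u v, g (a *: u + v) x = a *: g u x + g v x,
      forall x u, S x -> g u x = 0 -> u = 0,
      forall x (w : stalk F x), S x -> exists u, w = g u x &
      forall x u, S x -> exists (U : opens T) (s : F U),
        U x /\ forall y (Uy : U y), S y -> germ Uy s = g u y].
Proof.
move=> [r [f [h [fK hK]]]].
have clc u : @locally_constant k X ('rV[k]_r : lmodType k) (opensT X) (fun=> u).
  by move=> x; exists (opensT X).
pose c u : const_sheaf X ('rV[k]_r : lmodType k) (opensT X) := const_mk (clc u).
pose s u : restriction F S (opensT X) := h (opensT X) (c u).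
pose g u x : stalk F x := match pselect (S x) with
  | left Sx => restr_val (s u) (@stratum_point (opensT X) x Sx I)
  | right _ => 0 end.
have gE u x (Sx : S x) : g u x = restr_val (s u) (@stratum_point (opensT X) x Sx I).
  by rewrite /g; case: pselect => // Sx'; exact: restr_val_irr.
have cP a u v : c (a *: u + v) = a *: c u + c v.
  by apply: const_val_inj; apply/functional_extensionality_dep.
have gP x a u v : g (a *: u + v) x = a *: g u x + g v x.
  have [Sx|nS] := pselect (S x); last first.
    by rewrite /g; case: pselect => // _; rewrite scaler0 addr0.
  by rewrite !(gE _ _ Sx) /s cP linearP restr_valP.
have gloc x u : S x -> exists (U : opens T) (t : F U),
    U x /\ forall y (Uy : U y), S y -> germ Uy t = g u y.
  move=> Sx; have [N [U [t [Nx tP]]]] :=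
    restr_val_local (s u) (@stratum_point (opensT X) x Sx I).
  have [Q oQ QN] := opens_open N.
  have Qx : Q x by move: Nx; rewrite -QN.
  have [Ux _] := tP _ Nx.
  exists (opensI U (Opens oQ)), (res (@opensIl _ _ _) t); split=> // y Uy Sy.
  have [|Uy' E] := tP (@stratum_point (opensT X) y Sy I).
    by rewrite -QN; case: Uy.
  by rewrite (germ_res _ Uy' Uy) (gE _ _ Sy) E.
exists r, g; split=> //.
- move=> x u Sx gux; have [U [t [Ux tP]]] := gloc x u Sx.
  (* Then [t] vanishes near [x], so [s u] is 0 on the trace of a neighbourhood; applying [f], the
     constant [u] is 0 there. *)
  have : germ Ux t = germ Ux 0.
    by rewrite tP // gux germ0.
  move=> /germP[W [WU [WU2 [Wx t0]]]]; rewrite linear0 in t0.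
  have WT : trace S W `<=` opensT X by [].
  have : res WT (s u) = 0.
    apply: restr_val_inj; apply/functional_extensionality_dep => -[[y Sy] Wy].
    have Wy' : W y := set_mem Wy.
    have := gE u y (set_mem Sy); rewrite -(tP y (WU _ Wy')); last exact: set_mem.
    rewrite -(germ_res WU _ Wy') t0 germ0 => /esym E.
    rewrite -[RHS]E restr_val_res.
    exact: (@restr_val_irr (opensT X) (s u) y Sy (mem_set (set_mem Sy))).
  move=> r0.
  have c0 : res WT (c u) = 0 := etrans (esym (hK _ _))
    (etrans (congr1 (f _) (etrans (happ_res h WT (c u)) r0)) (linear0 (f _))).
  exact: (congr1 (fun z => const_val z (@stratum_point (trace S W) x Sx Wx)) c0).
- move=> x w Sx; have [U [Ux [t ->]]] := stalkP w.
  (* The germs of [t] form a section of the restriction. Its image under [f] is locally constant,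
     and the value at [x] is the required [u]. *)
  pose q : dprod (fun x : set_type (opens_set (trace S U)) => stalk F (val (val x))) :=
    fun z => germ (set_typeP z : U (val (val z))) t.
  have qloc : locally_section q.
    move=> z; exists (trace S U), U, t; split; first exact: set_typeP.
    by move=> y Uy; exists (set_typeP y).
  pose rho : restriction F S (trace S U) :=
    submod_mk (qloc : locally_section_submod _ _ q).
  pose z0 := @stratum_point (trace S U) x Sx Ux.
  have [N [Nx Nc]] := const_val_lc (f _ rho) z0.
  pose u := const_val (f _ rho) z0; exists u.
  have MU : opensI (trace S U) N `<=` trace S U := @opensIl _ _ _.
  have MT : opensI (trace S U) N `<=` opensT X by [].
  have E : res MU (f _ rho) = res MT (c u).
    apply: const_val_inj; apply/functional_extensionality_dep => z.
    by rewrite const_val_res; apply: Nc; have [] := set_typeP z.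
  have E' : res MU rho = res MT (s u) :=
    etrans (congr1 (fun t => res MU t) (esym (fK _ rho)))
      (etrans (esym (happ_res h MU (f _ rho)))
        (etrans (congr1 (h _) E) (happ_res h MT (c u)))).
  have := congr1 (fun d => restr_val d
    (@stratum_point (opensI (trace S U) N) x Sx (conj Ux Nx))) E'.
  rewrite !restr_val_res => E2; rewrite (gE _ _ Sx) /=.
  transitivity (restr_val rho
    (incl_set MU (@stratum_point (opensI (trace S U) N) x Sx (conj Ux Nx)))).
    exact: germ_irr.
  rewrite E2.
  exact: (@restr_val_irr (opensT X) (s u) x (mem_set Sx) (mem_set Sx)).
Qed.
End Stratum.

Lemma bounded_dim_surj (k : fieldType) (V : lmodType k) (r : nat)
    (f : {linear 'rV[k]_r -> V}) :
  (forall v, exists u, v = f u) -> bounded_dim V.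
Proof.
move=> fsurj.
have idlin : linear (fun u : 'rV[k]_r => u) by [].
have [n nP] := @bounded_dim_inj k 'rV[k]_r r (mk_linear idlin) (fun u v => id).
exists n => m y yfree; have /choice[g gP] := fun i => fsurj (y i).
apply: (nP m g) => d gd; apply: yfree.
rewrite (eq_bigr (fun i => f (d i *: g i))) => [|i _]; last by rewrite linearZ gP.
by rewrite -linear_sum gd linear0.
Qed.

Lemma locally_constant_connected (T : topologicalType) (Z : Type) (A : set T)
    (f : T -> Z) : connected A ->
  (forall x, A x -> exists N : opens T, N x /\ forall y, N y -> A y -> f y = f x) ->
  forall x y, A x -> A y -> f x = f y.
Proof.
move=> cA floc x y Ax Ay.
(* For [Q] equal to [id] or [not], an open set cutting out in [A] the points where [f] takes the
   value [f x], or the other points. *)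
pose Op (Q : Prop -> Prop) := \bigcup_(N in [set N : opens T |
  forall z, N z -> A z -> Q (f z = f x)]) (N : set T).
have oOp Q : open (Op Q) by apply: bigcup_open => N _; exact: opens_open.
have AE : [set z | A z /\ f z = f x] = A.
  apply: cA; first by exists x.
    exists (Op id) => //; rewrite predeqE => z; split=> [[Az zx]|[Az [N NP Nz]]].
      have [N [Nz NP]] := floc z Az; split=> //; exists N => // w Nw Aw.
      by rewrite NP.
    by split=> //; exact: NP.
  exists (~` Op not); first exact: open_closedC.
  rewrite predeqE => z; split=> [[Az zx]|[Az nO]].
    by split=> // -[N NP Nz]; exact: (NP z).
  split=> //; apply: contrapT => zx; apply: nO.
  have [N [Nz NP]] := floc z Az; exists N => // w Nw Aw.
  by rewrite NP.
have : [set z | A z /\ f z = f x] y by rewrite AE.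
by case.
Qed.

Section Propagation.
Context (R : realType) (k : fieldType) (F : sheaf k R).

Lemma propagates_zero (C : opens R) :
  (forall x, C x -> forall u : stalk F x, u = 0) -> propagates F C.
Proof.
move=> C0; split=> [x Cx u|U s UC iU x y Ux Uy _].
  by exists 0; rewrite germ0 (C0 _ Cx u).
by rewrite (C0 _ (UC _ Uy) (germ Uy s)).
Qed.

(** Locally a section over [C] is some [g v], which vanishes at one point only if [v = 0]. Vanishing
    is therefore a locally constant property along an interval. *)
Lemma propagates_stratum (S : set R) (C : opens R) :
  constant_of_finite_rank (restriction F S) -> C `<=` S -> propagates F C.
Proof.
move=> /stratum_frame[r [g [gP g_inj g_surj g_loc]]] CS.
have loc x u : C x -> is_local_section (g u) x.
  move=> Cx; have [U [s [Ux sP]]] := g_loc x u (CS _ Cx).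
  exists (opensI U C), (res (@opensIl _ U C) s); split=> // y Uy.
  by rewrite (germ_res _ Uy.1 Uy) sP //; apply: CS; case: Uy.
have g0 x : g 0 x = 0.
  by have := gP x 1 0 0; rewrite !scale1r addr0 => /eqP; rewrite -subr_eq subrr => /eqP.
split=> [x Cx u|U s UC iU x y Ux Uy sx0].
  have [v ->] := g_surj x u (CS _ Cx).
  have [|t tP] := @glue_germs _ _ F C (g v); last by exists t.
  by move=> z; exact: loc.
pose vanishes z := forall Uz : U z, germ Uz s = 0.
have /connected_intervalP cU := iU.
have vanishes_loc z : U z -> exists W : opens R, W z /\
    forall w, W w -> U w -> vanishes w = vanishes z.
  move=> Uz; have [v vE] := g_surj z (germ Uz s) (CS _ (UC _ Uz)).
  have [N [t [Nz tN]]] := loc z v (UC _ Uz).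
  have /germP[W [WU [WN [Wz E]]]] : germ Uz s = germ Nz t by rewrite vE tN.
  have vanishesE w (Ww : W w) : vanishes w <-> v = 0.
    have wE : germ (WU _ Ww) s = g v w.
      by rewrite -(germ_res WU _ Ww) E (germ_res WN (WN _ Ww)) tN.
    split=> [/(_ (WU _ Ww))|v0 Uw].
      by rewrite wE; apply: g_inj; apply/CS/UC/WU.
    by rewrite (Prop_irrelevance Uw (WU _ Ww)) wE v0 g0.
  by exists W; split=> // w Ww _; apply/propext; rewrite !vanishesE.
have : vanishes x by move=> Ux'; rewrite (Prop_irrelevance Ux' Ux).
by rewrite (locally_constant_connected cU vanishes_loc Ux Uy); exact.
Qed.

Lemma bounded_dim_stratum (S : set R) x : S x ->
  constant_of_finite_rank (restriction F S) -> bounded_dim (stalk F x : lmodType k).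
Proof.
move=> Sx /stratum_frame[r [g [gP _ g_surj _]]].
apply: (@bounded_dim_surj k _ r (mk_linear (gP x))) => v.
by have [u ->] := g_surj x v Sx; exists u.
Qed.

Lemma stalk_supp x : ~ sheaf_supp F x -> forall u : stalk F x, u = 0.
Proof.
move=> /contrapT[N [Nx N0]] u; have [U [Ux [s ->]]] := stalkP u.
have IN : opensI N U `<=` N := @opensIl _ _ _.
have IU : opensI N U `<=` U := @opensIr _ _ _.
have Ix : opensI N U x by [].
by rewrite -(germ_res IU Ux Ix) (N0 _ IN (res IU s)) germ0.
Qed.
End Propagation.

Lemma locally_finite_compact (R : realType) (P : set (set R)) (K : set R) :
  locally_finite P -> compact K ->
  finite_set (P `&` [set S | S `&` K !=set0]).
Proof.
move=> /choice[U UP]; rewrite compact_cover => cK.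
have [|x Kx|D _ KD] := cK R setT (fun x => (U x)°).
- by move=> x _; exact: open_interior.
- by exists x => //; have [] := UP x.
have sub : P `&` [set S | S `&` K !=set0] `<=`
    \bigcup_(x in [set` D]) (P `&` [set S | S `&` U x !=set0]).
  move=> S [PS [x [Sx /KD[y Dy Uy]]]]; exists y => //; split=> //.
  by exists x; split=> //; exact: interior_subset.
apply: sub_finite_set sub _; apply: bigcup_finite; first exact: finite_fset.
by move=> x _; have [] := UP x.
Qed.

(** * Numbering the cells cut out by finitely many points *)

Section CountCells.
Context (R : realType) (ts : seq R).
Hypothesis ts_sorted : sorted <%O ts.

(** Twice the number of points of [ts] to the left of [x], plus one if [x] is in [ts]: gaps get even
    numbers and points odd ones, from left to right. *)
Definition count_cell (x : R) : nat :=
  (count (fun t => (t < x)%R) ts + count (fun t => (t <= x)%R) ts)%N.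

Lemma count_lt_le (x : R) :
  (count (fun t => (t < x)%R) ts <= count (fun t => (t <= x)%R) ts)%N.
Proof. by apply: sub_count => t /= /ltW. Qed.

Lemma count_cell_size (x : R) : (count_cell x <= (size ts).*2)%N.
Proof. by rewrite -addnn leq_add ?count_size. Qed.

Lemma count_cell_mono (x y : R) : x <= y -> (count_cell x <= count_cell y)%N.
Proof.
move=> xy; apply: leq_add; apply: sub_count => t /= tx.
  exact: lt_le_trans xy.
exact: le_trans xy.
Qed.

(** For [x < y], the two counts at [x] are at most the two at [y]; equal sums force all four to
    coincide, and the number of [x] is then even. *)
Lemma count_cell_odd (x y : R) :
  odd (count_cell x) -> count_cell x = count_cell y -> x = y.
Proof.
wlog xy : x y / x < y => [H|].
  have [xy|yx|//] := ltgtP x y; first exact: H.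
  by move=> ox E; apply/esym/H; rewrite -?E.
have le : (count (fun t => (t <= x)%R) ts <= count (fun t => (t < y)%R) ts)%N.
  by apply: sub_count => t /= tx; exact: le_lt_trans xy.
have hx := count_lt_le x; have hy := count_lt_le y.
rewrite /count_cell => ox E; exfalso; move: ox.
have -> : count (fun t => (t < x)%R) ts = count (fun t => (t <= x)%R) ts by lia.
by rewrite addnn odd_double.
Qed.

Lemma count_cell_mem (x : R) : x \in ts -> odd (count_cell x).
Proof.
move=> xts; rewrite /count_cell -(nth_index 0 xts).
rewrite count_lt_nth ?index_mem // count_le_nth ?index_mem //.
by rewrite addnS addnn /= odd_double.
Qed.

Lemma exists_gt_seq (a : R) (s : seq R) :
  exists2 x, a < x & forall t, t \in s -> a < t -> x < t.
Proof.
elim: s => [|t s [x ax xs]]; first by exists (a + 1); rewrite // ltrDl.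
have [ta|at_] := leP t a.
  by exists x => // u; rewrite inE => /orP[/eqP->|]; [rewrite ltNge ta|exact: xs].
have m0 : 0 < Num.min (x - a) (t - a) by rewrite lt_min !subr_gt0 ax.
exists (a + Num.min (x - a) (t - a) / 2); first by rewrite ltrDl divr_gt0.
have mlt : a + Num.min (x - a) (t - a) / 2 < a + Num.min (x - a) (t - a).
  by rewrite ltrD2l ltr_pdivrMr // ltr_pMr // ltr1n.
move=> u; rewrite inE => /orP[/eqP-> _|us au].
  by apply: lt_le_trans mlt _; rewrite -lerBrDl ge_min lexx orbT.
apply: lt_trans (xs u us au); apply: lt_le_trans mlt _.
by rewrite -lerBrDl ge_min lexx.
Qed.

Lemma exists_lt_seq (s : seq R) : exists x : R, forall t, t \in s -> x < t.
Proof.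
elim: s => [|t s [x xs]]; first by exists 0.
exists (Num.min x t - 1) => u; rewrite inE => /orP[/eqP->|/xs xu].
  by rewrite ltrBlDr (le_lt_trans (y := t)) ?ltrDl // ge_min lexx orbT.
by rewrite ltrBlDr (le_lt_trans (y := x)) ?ltr_wpDr // ge_min lexx.
Qed.

Lemma count_cell_onto i : (i <= (size ts).*2)%N -> exists x, count_cell x = i.
Proof.
move=> iN; have [oi|ei] := boolP (odd i).
  exists (nth 0 ts i./2).
  have hi : (i./2 < size ts)%N by lia.
  by rewrite /count_cell count_lt_nth // count_le_nth //; lia.
case: i iN ei => [_ _|i iN /negbTE ei].
  have [x xts] := exists_lt_seq ts; exists x; rewrite /count_cell.
  rewrite !(eq_in_count (a2 := pred0)) ?count_pred0 // => t /xts /= xt.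
    by rewrite leNgt xt.
  by rewrite ltNge (ltW xt).
(* Cell [i.+1] is the gap following the point of index [i./2], and is reached just to the right of
   that point. *)
have hi : (i./2 < size ts)%N by move: ei => /=; lia.
have [x ax xP] := exists_gt_seq (nth 0 ts i./2) ts.
have xE t : t \in ts ->
    (t <= nth 0 ts i./2) = (t <= x) /\ (t <= nth 0 ts i./2) = (t < x).
  move=> tts; have [ta|at_] := leP t (nth 0 ts i./2).
    by rewrite (le_lt_trans ta ax) (ltW (le_lt_trans ta ax)).
  have xt := xP t tts at_.
  by rewrite leNgt xt ltNge (ltW xt).
exists x; rewrite /count_cell.
rewrite (eq_in_count (a1 := fun t => (t < x)%R)
  (a2 := fun t => (t <= nth 0 ts i./2)%R)); last first.
  by move=> t /xE[_ ->].
rewrite (eq_in_count (a1 := fun t => (t <= x)%R)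
  (a2 := fun t => (t <= nth 0 ts i./2)%R)); last first.
  by move=> t /xE[->].
by rewrite count_le_nth //; move: ei => /=; lia.
Qed.

Lemma near_count_cell (x : R) : x \notin ts ->
  \forall y \near x, count_cell y = count_cell x.
Proof.
move=> xts.
suff : \forall y \near x, forall t, t \in ts ->
    (t < y) = (t < x) /\ (t <= y) = (t <= x).
  apply: filterS => y yE; rewrite /count_cell; congr (_ + _)%N;
  by apply: eq_in_count => t /yE[].
elim: (ts) xts => [|t s IHs]; first by move=> _; near=> y.
rewrite inE negb_or => /andP[xt /IHs H].
have Ht : \forall y \near x, (t < y) = (t < x) /\ (t <= y) = (t <= x).
  move: xt; rewrite neq_lt => /orP[xt|tx].
    have : nbhs x `]-oo, t[%classic.
      by apply: open_nbhs_nbhs; split; [exact: interval_open|rewrite /= in_itv].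
    apply: filterS => y /=; rewrite in_itv /= => yt.
    by rewrite (lt_gtF yt) (lt_gtF xt) (lt_geF yt) (lt_geF xt).
  have : nbhs x `]t, +oo[%classic.
    by apply: open_nbhs_nbhs; split; [exact: interval_open|rewrite /= in_itv /= tx].
  apply: filterS => y /=; rewrite in_itv /= andbT => ty.
  by rewrite ty tx (ltW ty) (ltW tx).
apply: filterS2 H Ht => y ys yt u; rewrite inE => /orP[/eqP->//|]; exact: ys.
Unshelve. all: by end_near.
Qed.
End CountCells.

(** The line is cut at [- M], [M] and the endpoints of the strata inside [K]. An even cell then lies
    in one stratum or outside [K], and [F] propagates along it in both cases. *)
Theorem constructible_decomposition (R : realType) (k : fieldType) (F : sheaf k R) :
  constructible F -> compact (sheaf_supp F) ->
  exists (A : finType) (I : A -> set R) (n : A -> nat),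
    interval_decomposition F I n.
Proof.
move=> [P [[[covP _ _] lfP connP _] constP]] /compact_bounded[M0 [_ M0P]].
have stratum x : exists S, P S /\ S x.
  by have : [set: R] x by []; rewrite -covP => -[S PS Sx]; exists S.
pose M := Num.max (M0 + 1) 1.
have suppM x : sheaf_supp F x -> - M <= x <= M.
  by rewrite -ler_norml; apply: M0P; rewrite /M lt_max ltrDl ltr01.
pose K : set R := `[- M, M]%classic.
have KE x : K x <-> - M <= x <= M by rewrite /K /= in_itv.
have finP : finite_set (P `&` [set S | S `&` K !=set0]).
  by apply: locally_finite_compact lfP _; exact: segment_compact.
(* Strata may be unbounded; intersecting with [K] gives real endpoints, and only finitely many
   strata meet [K]. *)
pose D := [set - M; M] `|`
  ((fun S => inf (S `&` K)) @` (P `&` [set S | S `&` K !=set0]) `|`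
   (fun S => sup (S `&` K)) @` (P `&` [set S | S `&` K !=set0])).
have : finite_set D.
  rewrite !finite_setU; split; first by split; exact: finite_set1.
  by split; exact: finite_image.
move=> /finite_seqP[s sD]; pose ts := sort <=%O (undup s).
have ts_sorted : sorted <%O ts by rewrite sort_lt_sorted undup_uniq.
have tsD t : D t -> t \in ts by rewrite sD mem_sort mem_undup.
(* Interiors make [C i] open for every [i]; for even [i] the cell is already open, by
   [near_count_cell]. *)
pose C i := Opens (open_interior [set x | count_cell ts x = i]).
have CE i : ~~ odd i -> forall x, C i x <-> count_cell ts x = i.
  move=> ei x; split; first exact: interior_subset.
  move=> xi; have xts : x \notin ts.
    by apply/negP => /(count_cell_mem ts_sorted); rewrite xi (negbTE ei).
  by have := near_count_cell xts; apply: filterS => y /= ->.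
have gap i x y t : ~~ odd i -> C i x -> C i y -> D t -> x <= t <= y -> False.
  move=> ei /(CE _ ei) xi /(CE _ ei) yi /tsD /(count_cell_mem ts_sorted) ot /andP[xt ty].
  have := count_cell_mono ts xt; have := count_cell_mono ts ty.
  rewrite xi yi => h1 h2; have ti : count_cell ts t = i by lia.
  by move: ot; rewrite ti (negbTE ei).
have D1 : D (- M) by left; left.
have D2 : D M by left; right.
have Cprop i : ~~ odd i -> propagates F (C i).
  move=> ei; have [[x Cx]|nC] := pselect (exists x, C i x); last first.
    by apply: propagates_zero => x Cx; case: nC; exists x.
  have [Kx|nK] := pselect (K x).
    have [S [PS Sx]] := stratum x.
    have Sint : is_interval S by apply/connected_intervalP; have [] := connP _ PS.
    have SKx : (S `&` K) x by [].
    have PK : (P `&` [set S | S `&` K !=set0]) S by split=> //; exists x.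
    apply: (propagates_stratum (constP _ PS)) => y Cy.
    have SK0 : S `&` K !=set0 by exists x.
    have [xy|xy|<-//] := ltgtP x y.
      (* If no point of [S] in [K] exceeded [y], their supremum would be a cut point between [x] and
         [y], inside an even cell. *)
      have [|z [Sz _] yz] := @sup_gt R (S `&` K) y SK0.
        rewrite ltNge; apply/negP => sy.
        apply: (gap i x y (sup (S `&` K))) => //; first by right; right; exists S.
        rewrite sy andbT; apply: ub_le_sup => //.
        by exists M => z [_ /KE /andP[]].
      by apply: (Sint x z) => //; rewrite !ltW.
    have [|z [Sz _] zy] := @inf_lt R (S `&` K) y SK0.
      rewrite ltNge; apply/negP => sy.
      apply: (gap i y x (inf (S `&` K))) => //; first by right; left; exists S.
      rewrite sy /=; apply: ge_inf => //.
      by exists (- M) => z [_ /KE /andP[]].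
    by apply: (Sint z x) => //; rewrite !ltW.
  (* The cut points [- M] and [M] keep a cell with one point outside [K] entirely outside [K], hence
     off the support. *)
  apply: propagates_zero => y Cy; apply: stalk_supp => /suppM yM.
  apply: nK; apply/KE; move: yM => /andP[My yM]; apply/andP; split.
    rewrite leNgt; apply/negP => xM.
    by apply: (gap i x y (- M)) => //; rewrite My ltW.
  rewrite leNgt; apply/negP => xM.
  by apply: (gap i y x M) => //; rewrite yM ltW.
have /choice[p pE] (i : nat) :
    exists x, (i <= (size ts).*2)%N -> count_cell ts x = i.
  have [iN|_] := boolP (i <= (size ts).*2)%N; last by exists 0.
  by have [x xi] := count_cell_onto ts_sorted iN; exists x.
apply: (@cells_decomposition R k F (size ts).*2 (count_cell ts) p C).
  split=> //; first by rewrite odd_double.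
  - exact: count_cell_size.
  - exact: count_cell_mono.
  - exact: count_cell_odd.
move=> x; have [S [PS Sx]] := stratum x.
exact: bounded_dim_stratum Sx (constP _ PS).
Qed.

(** * Uniqueness of the decomposition *)

Section SheafHom.
Context (k : fieldType) (T : topologicalType).

Fact comp_hom_linear (F G H : sheaf k T) (f : sheaf_hom F G) (g : sheaf_hom G H)
  (U : opens T) : linear (fun s : F U => g U (f U s)).
Proof. by move=> a s t; rewrite !linearP. Qed.

Fact comp_hom_res (F G H : sheaf k T) (f : sheaf_hom F G) (g : sheaf_hom G H)
  (U V : opens T) (VU : V `<=` U) (s : F U) :
  mk_linear (comp_hom_linear f g (U := V)) (res VU s) =
  res VU (mk_linear (comp_hom_linear f g (U := U)) s).
Proof. by rewrite /= !happ_res. Qed.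

Definition comp_hom (F G H : sheaf k T) (f : sheaf_hom F G) (g : sheaf_hom G H) :
  sheaf_hom F H := SheafHom (comp_hom_res f g).

Lemma sheaf_iso_span (F G H : sheaf k T) :
  sheaf_iso F G -> sheaf_iso F H -> sheaf_iso G H.
Proof.
move=> [f [g [fg gf]]] [f' [g' [fg' gf']]].
exists (comp_hom g f'), (comp_hom g' f); split=> U s /=.
  by rewrite fg' gf.
by rewrite fg gf'.
Qed.
End SheafHom.

(** [I] is closed in the open set [U], so that the indicator of [I] is a section of [k_I] over
    [U]. *)
Definition locally_closed_in (T : topologicalType) (I : set T) (U : opens T) : Prop :=
  I `<=` U /\ forall x, U x -> ~ I x ->
    exists N : opens T, N x /\ forall y, N y -> ~ I y.

(** An open set in which [I] is closed must avoid the points of [closure I] outside [I]; removing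
    only these gives [A]. It is a neighbourhood of each point of [I], as on each side [I] either
    contains a segment or has no point at all. *)
Lemma interval_locally_closed (R : realType) (I : set R) :
  is_interval I -> exists U, locally_closed_in I U.
Proof.
move=> iI; pose A : set R := [set x | I x \/ ~ closure I x].
exists (Opens (open_interior A)); split=> [x Ix /=|x /interior_subset[//|nx] nIx].
  have [lo [lox loP]] : exists lo, lo < x /\ forall w, lo < w < x -> A w.
    have [[lo [Ilo lox]]|nlo] := pselect (exists lo, I lo /\ lo < x).
      exists lo; split=> // w /andP[lw wx]; left; apply: (iI lo x) => //.
      by rewrite !ltW.
    exists (x - 1); split; first by rewrite ltrBlDr ltrDl.
    move=> w /andP[_ wx]; right => cw.
    have : nbhs w `]-oo, x[%classic.
      by apply: open_nbhs_nbhs; split; [exact: interval_open|rewrite /= in_itv].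
    move=> /cw[z [Iz /=]]; rewrite in_itv /= => zx.
    by apply: nlo; exists z.
  have [hi [xhi hiP]] : exists hi, x < hi /\ forall w, x < w < hi -> A w.
    have [[hi [Ihi xhi]]|nhi] := pselect (exists hi, I hi /\ x < hi).
      exists hi; split=> // w /andP[lw wx]; left; apply: (iI x hi) => //.
      by rewrite !ltW.
    exists (x + 1); split; first by rewrite ltrDl.
    move=> w /andP[xw _]; right => cw.
    have : nbhs w `]x, +oo[%classic.
      by apply: open_nbhs_nbhs; split; [exact: interval_open|rewrite /= in_itv /= xw].
    move=> /cw[z [Iz /=]]; rewrite in_itv /= andbT => xz.
    by apply: nhi; exists z.
  have : nbhs x `]lo, hi[%classic.
    apply: open_nbhs_nbhs; split; first exact: interval_open.
    by rewrite /= in_itv /= lox.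
  apply: filterS => w /=; rewrite in_itv /= => /andP[low whi].
  have [wx|xw|->] := ltgtP w x; [|by apply: hiP; rewrite xw|by left].
  by apply: loP; rewrite low.
exists (Opens (closed_openC (@closed_closure _ I))); split=> //= y cy Iy.
by apply: cy; exact: subset_closure.
Qed.

(** * Morphisms between direct sums as matrices of functions *)

Section DsumHom.
Context (k : fieldType) (T : topologicalType).

Fact kval_is_linear (I : set T) (U : opens T) x :
  linear ((fun s => kval s x) : k_sheaf k I U -> k^o).
Proof. exact (fun c s t => kval_linear c s t x). Qed.

Lemma kval0 (I : set T) (U : opens T) x : kval (0 : k_sheaf k I U) x = 0.
Proof. exact: (linear0 (mk_linear (@kval_is_linear I U x))). Qed.

Section OneDsum.
Context (A : finType) (I : A -> set T) (n : A -> nat).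
Notation G := (dsum (fun a => dsum_pow (n a) (k_sheaf k (I a)))).
Notation index := {a : A & 'I_(n a)}.

Definition dsum_coord (U : opens T) (s : G U) (p : index) : T -> k :=
  dsum_val s (tag p) (tagged p).

Lemma dsum_coord_inj (U : opens T) (s t : G U) :
  (forall p x, U x -> dsum_coord s p x = dsum_coord t p x) -> s = t.
Proof.
by move=> st; apply: dsum_val_inj => a i x; exact: (st (Tagged (fun a => 'I_(n a)) i)).
Qed.

Lemma dsum_coord_linear (U : opens T) p x :
  linear ((fun s => dsum_coord s p x) : G U -> k^o).
Proof. exact (fun c s t => dsum_val_linear c s t (tagged p) x). Qed.

Lemma dsum_coord_sum (U : opens T) (K : finType) (c : K -> k) (s : K -> G U) p x :
  dsum_coord (\sum_i c i *: s i) p x = \sum_i c i * dsum_coord (s i) p x.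
Proof.
pose f : {linear G U -> k^o} := mk_linear (@dsum_coord_linear U p x).
rewrite -[LHS]/(f _) (linear_sum f); apply: eq_bigr => i _.
exact (linearZZ f (c i) (s i)).
Qed.

Lemma dsum_coord_out (U : opens T) (s : G U) p x :
  ~ I (tag p) x -> dsum_coord s p x = 0.
Proof. exact: kval_out. Qed.

Lemma dsum_coord_res (U V : opens T) (VU : V `<=` U) (s : G U) p x :
  V x -> dsum_coord (res VU s) p x = dsum_coord s p x.
Proof. exact: dsum_val_res. Qed.

Lemma dsum_coord_local (U : opens T) (s : G U) p x : U x ->
  exists N : opens T, N x /\
    forall y, N y -> U y -> I (tag p) y -> dsum_coord s p y = dsum_coord s p x.
Proof. exact: kval_local. Qed.

Lemma single_component (U : opens T) (p : index) (s : k_sheaf k (I (tag p)) U) :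
  exists t : G U, forall q x, U x -> dsum_coord t q x = if q == p then kval s x else 0.
Proof.
have [|t tP] := @dsum_val_mk k T A I n U
    (fun a i x => if Tagged (fun a => 'I_(n a)) i == p then kval s x else 0).
  move=> a i; case: p s => b j s.
  have [E|_] := eqVneq; last by exists 0 => x _; rewrite kval0.
  have Eb : b = a by exact: (esym (congr1 tag E)).
  by move: s; rewrite /= Eb => s; exists s.
by exists t => -[a i] x Ux; rewrite /dsum_coord tP.
Qed.
End OneDsum.
Arguments dsum_coord [A I n U] s p x.

Section TwoDsum.
Context (A B : finType) (I : A -> set T) (J : B -> set T).
Context (n : A -> nat) (m : B -> nat).
Notation G := (dsum (fun a => dsum_pow (n a) (k_sheaf k (I a)))).
Notation H := (dsum (fun b => dsum_pow (m b) (k_sheaf k (J b)))).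
Context (U : A -> opens T).
Hypothesis UI : forall a, locally_closed_in (I a) (U a).

Lemma unit_section (p : {a : A & 'I_(n a)}) : exists s : G (U (tag p)),
  forall q x, U (tag p) x -> dsum_coord s q x = ((q == p) && `[< I (tag p) x >])%:R.
Proof.
have [IU Iloc] := UI (tag p).
have [|x Ux|s sP] := @kval_mk k T (I (tag p)) (U (tag p))
    (fun x => `[< I (tag p) x >]%:R).
- by move=> x nI; rewrite asboolF.
- have [Ix|nIx] := pselect (I (tag p) x).
    exists (U (tag p)); split=> // y _ _ Iy; by rewrite !asboolT.
  have [N [Nx NI]] := Iloc x Ux nIx.
  by exists N; split=> // y Ny _ Iy; case: (NI y).
have [t tP] := single_component s.
exists t => q x Ux; rewrite tP //; case: eqP => //= _; exact: sP.
Qed.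

Definition unit_sec p : G (U (tag p)) := projT1 (cid (unit_section p)).

Lemma unit_secE p q x : U (tag p) x ->
  dsum_coord (unit_sec p) q x = ((q == p) && `[< I (tag p) x >])%:R.
Proof. exact: (projT2 (cid (unit_section p))). Qed.

Context (phi : sheaf_hom G H).

Definition hom_coef p q x : k := dsum_coord (phi (U (tag p)) (unit_sec p)) q x.

(* Near x, a section s of the direct sum is the combination of the unit
   sections with coefficients its values at x. *)
Lemma hom_coord (V : opens T) (s : G V) q x : V x ->
  dsum_coord (phi V s) q x = \sum_p dsum_coord s p x * hom_coef p q x.
Proof.
move=> Vx.
(* There are finitely many indices, so one neighbourhood serves them all. A coordinate is frozen
   only on its own interval, as it vanishes elsewhere. *)
have near_x : \forall y \near x, V y /\ forall p : {a : A & 'I_(n a)},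
    (I (tag p) x -> U (tag p) y) /\ (I (tag p) y -> dsum_coord s p y = dsum_coord s p x).
  have nV : \forall y \near x, V y by exact: open_nbhs_nbhs (conj (opens_open V) Vx).
  apply: filterS2 nV _ => [y Vy h|]; first exact: (conj Vy h).
  apply: filter_forall => p.
  have [N [Nx NP]] := dsum_coord_local s p Vx.
  have nN : \forall y \near x, N y by exact: open_nbhs_nbhs (conj (opens_open N) Nx).
  have nU : \forall y \near x, I (tag p) x -> U (tag p) y.
    have [Ix|nIx] := pselect (I (tag p) x); last by apply: filterE.
    have [IU _] := UI (tag p).
    have := open_nbhs_nbhs (conj (opens_open (U (tag p))) (IU x Ix)).
    by apply: filterS.
  have nV' : \forall y \near x, V y by exact: open_nbhs_nbhs (conj (opens_open V) Vx).
  apply: filterS3 nN nU nV' => y Ny Uy Vy.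
  exact: (conj Uy (fun Iy => NP y Ny Vy Iy)).
pose W := Opens (open_interior [set y | V y /\ forall p : {a : A & 'I_(n a)},
    (I (tag p) x -> U (tag p) y) /\ (I (tag p) y -> dsum_coord s p y = dsum_coord s p x)]).
have Wx : W x by [].
have WP y : W y -> V y /\ forall p : {a : A & 'I_(n a)},
    (I (tag p) x -> U (tag p) y) /\ (I (tag p) y -> dsum_coord s p y = dsum_coord s p x).
  exact: interior_subset.
have WV : W `<=` V by move=> y /WP[].
(* If [x] is outside [I (tag p)], the unit section may not be defined near [x]; its coefficient is
   0, and 0 replaces it. *)
have /choice[w wP] (p : {a : A & 'I_(n a)}) : exists w : G W,
    (forall WU : W `<=` U (tag p), I (tag p) x -> w = res WU (unit_sec p)) /\
    (~ I (tag p) x -> w = 0).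
  have [Ix|nIx] := pselect (I (tag p) x); last by exists 0.
  have WU : W `<=` U (tag p) by move=> y /WP[_ /(_ p)[]] /(_ Ix).
  exists (res WU (unit_sec p)); split=> // WU' _.
  by rewrite (Prop_irrelevance WU' WU).
have WU (p : {a : A & 'I_(n a)}) : I (tag p) x -> W `<=` U (tag p).
  by move=> Ix y /WP[_ /(_ p)[]] /(_ Ix).
have resE : res WV s = \sum_p dsum_coord s p x *: w p.
  apply: dsum_coord_inj => q' y Wy; rewrite dsum_coord_res //.
  rewrite dsum_coord_sum (bigD1 q') //= big1 ?addr0 => [|p pq].
    have [Ix|nIx] := pselect (I (tag q') x); last first.
      rewrite (dsum_coord_out s nIx) mul0r.
      have [Iy|nIy] := pselect (I (tag q') y); last by rewrite dsum_coord_out.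
      by have [_ /(_ q')[_ ->]] := WP y Wy; rewrite // dsum_coord_out.
    have [wE _] := wP q'.
    rewrite (wE (WU _ Ix) Ix) dsum_coord_res // unit_secE; last exact: WU.
    rewrite eqxx /=; have [Iy|nIy] := pselect (I (tag q') y).
      rewrite asboolT // mulr1.
      by have [_ /(_ q')[_ ->]] := WP y Wy.
    by rewrite asboolF // mulr0 dsum_coord_out.
  have [wE w0] := wP p; have [Ix|nIx] := pselect (I (tag p) x).
    rewrite (wE (WU _ Ix) Ix) dsum_coord_res // unit_secE; last exact: WU.
    by rewrite eq_sym (negbTE pq) mulr0.
  by rewrite (dsum_coord_out s nIx) mul0r.
have phiE : phi W (\sum_p dsum_coord s p x *: w p) =
    \sum_p dsum_coord s p x *: phi W (w p).
  rewrite (linear_sum (phi W)); apply: eq_bigr => p _.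
  exact (linearZZ (phi W) (dsum_coord s p x) (w p)).
rewrite -(dsum_coord_res WV _ _ Wx) -happ_res resE phiE dsum_coord_sum.
apply: eq_bigr => p _; have [wE w0] := wP p.
have [Ix|nIx] := pselect (I (tag p) x); last by rewrite (dsum_coord_out s nIx) !mul0r.
by rewrite (wE (WU _ Ix) Ix) happ_res dsum_coord_res.
Qed.

End TwoDsum.
End DsumHom.

(** * Round trips between two summands *)

Section Multiplicity.
Context (k : fieldType) (T : topologicalType).
Context (A B : finType) (I : A -> set T) (J : B -> set T).
Context (n : A -> nat) (m : B -> nat).
Notation G := (dsum (fun a => dsum_pow (n a) (k_sheaf k (I a)))).
Notation H := (dsum (fun b => dsum_pow (m b) (k_sheaf k (J b)))).
Context (U : A -> opens T) (V : B -> opens T).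
Hypothesis UI : forall a, locally_closed_in (I a) (U a).
Hypothesis VJ : forall b, locally_closed_in (J b) (V b).
Hypothesis I_conn : forall a, connected (I a).
Context (phi : sheaf_hom G H) (psi : sheaf_hom H G).

(* The product is the coefficient of an endomorphism of k_(I a), namely
   k_(I a) -> k_(J b) -> k_(I a). *)
Lemma hom_coef_comp_const (a : A) (b : B) (i i' : 'I_(n a)) (j j' : 'I_(m b)) x y :
  I a x -> I a y ->
  let c z := hom_coef UI phi (Tagged _ i) (Tagged _ j) z *
    hom_coef VJ psi (Tagged _ j') (Tagged _ i') z in
  c x = c y.
Proof.
move=> Ix Iy c.
pose p : {a : A & 'I_(n a)} := Tagged (fun a => 'I_(n a)) i.
pose p' : {a : A & 'I_(n a)} := Tagged (fun a => 'I_(n a)) i'.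
pose q : {b : B & 'I_(m b)} := Tagged (fun b => 'I_(m b)) j.
pose q' : {b : B & 'I_(m b)} := Tagged (fun b => 'I_(m b)) j'.
have [IU _] := UI a.
(* Only coordinate [j] of the image of the unit section is kept, moved to place [j']. This isolates
   one product from the matrix sum: [c] is a coordinate of the single section [psi (U a) t]. *)
have [t tP] := @single_component k T B J m (U a) q'
  ((phi (U a) (unit_sec k UI p) : forall b, dsum_pow (m b) (k_sheaf k (J b)) (U a)) b j).
have cE z : I a z -> dsum_coord (psi (U a) t) p' z = c z.
  move=> Iz; rewrite (hom_coord VJ psi t p' (IU _ Iz)) (bigD1 q') //= big1 ?addr0.
    by rewrite tP ?eqxx //; exact: IU.
  by move=> r rq; rewrite tP; [rewrite (negbTE rq) mul0r|exact: IU].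
rewrite -!cE //; apply: locally_constant_connected (@I_conn a) _ _ _ Ix Iy => z Iz.
have [N [Nz NP]] := dsum_coord_local (psi (U a) t) p' (IU _ Iz).
by exists N; split=> // w Nw Iw; apply: NP => //; exact: IU.
Qed.
End Multiplicity.

(** * Comparison of multiplicities *)

Section Uniqueness.
Context (k : fieldType) (T : topologicalType).
Context (A B : finType) (I : A -> set T) (J : B -> set T).
Context (n : A -> nat) (m : B -> nat).
Notation G := (dsum (fun a => dsum_pow (n a) (k_sheaf k (I a)))).
Notation H := (dsum (fun b => dsum_pow (m b) (k_sheaf k (J b)))).
Context (U : A -> opens T) (V : B -> opens T).
Hypothesis UI : forall a, locally_closed_in (I a) (U a).
Hypothesis VJ : forall b, locally_closed_in (J b) (V b).
Hypothesis I_conn : forall a, connected (I a).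
Hypothesis J_conn : forall b, connected (J b).

(** The product is constant along [I a], and zero at any point of [I a] outside [J b]. If [I a] lies
    in [J b], the product read in the other order is constant along [J b] and zero at a point of
    [J b] outside [I a]. *)
Lemma hom_coef_comp0 (phi : sheaf_hom G H) (psi : sheaf_hom H G)
    (a : A) (b : B) (i i' : 'I_(n a)) (j : 'I_(m b)) x :
  J b <> I a -> I a x ->
  hom_coef UI phi (Tagged _ i) (Tagged _ j) x *
    hom_coef VJ psi (Tagged _ j) (Tagged _ i') x = 0.
Proof.
move=> JI Ix; have [[z [Iz nJ]]|IJ] := pselect (exists z, I a z /\ ~ J b z).
  rewrite (hom_coef_comp_const UI VJ I_conn phi psi i i' j j Ix Iz).
  by rewrite [X in X * _]dsum_coord_out ?mul0r.
have [[z [Jz nI]]|nJI] := pselect (exists z, J b z /\ ~ I a z).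
  have Jx : J b x by apply: contrapT => nJ; apply: IJ; exists x.
  rewrite mulrC (hom_coef_comp_const VJ UI J_conn psi phi j j i' i Jx Jz).
  by rewrite [X in X * _]dsum_coord_out ?mul0r.
exfalso; apply: JI; rewrite predeqE => z.
by split=> ?; apply: contrapT => ?; [apply: nJI|apply: IJ]; exists z.
Qed.

(** Evaluation at one point of [I a] is enough. Injectivity of [J] leaves a single block in the sum
    over [b], and the inequality is a rank estimate. *)
Lemma multiplicity_le (a : A) : injective J -> I a !=set0 -> (0 < n a)%N ->
  sheaf_iso G H -> exists b, J b = I a /\ (n a <= m b)%N.
Proof.
move=> J_inj [x Ix] na [phi [psi [phiK _]]].
pose c i b (j : 'I_(m b)) := hom_coef UI phi
  (Tagged (fun a => 'I_(n a)) (i : 'I_(n a))) (Tagged (fun b => 'I_(m b)) j) x.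
pose d b (j : 'I_(m b)) i := hom_coef VJ psi
  (Tagged (fun b => 'I_(m b)) j) (Tagged (fun a => 'I_(n a)) (i : 'I_(n a))) x.
have cd i i' : (i == i')%:R = \sum_b \sum_(j < m b) c i b j * d b j i'.
  pose p := Tagged (fun a => 'I_(n a)) i; pose p' := Tagged (fun a => 'I_(n a)) i'.
  have [IU _] := UI a; have Ux := IU _ Ix.
  have := unit_secE k UI (p := p) p' Ux.
  rewrite asboolT // andbT (_ : (p' == p) = (i == i')); last first.
    by rewrite eq_Tagged /= eq_sym.
  move=> <-; rewrite -[X in dsum_coord X](phiK (U a)) (hom_coord VJ psi _ _ Ux).
  by rewrite sig_big_dep; apply: eq_bigr => -[].
have zero b : J b <> I a -> forall i i', \sum_(j < m b) c i b j * d b j i' = 0.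
  by move=> JI i i'; apply: big1 => j _; exact: hom_coef_comp0.
have [[b Jb]|nb] := pselect (exists b, J b = I a); last first.
  (* Without such a [b] all blocks vanish, and the diagonal entry provided by [na] reads 1 = 0. *)
  have := cd (Ordinal na) (Ordinal na); rewrite eqxx big1.
    by move/eqP; rewrite oner_eq0.
  by move=> b _; apply: zero => Jb; apply: nb; exists b.
exists b; split=> //.
pose M : 'M[k]_(n a, m b) := \matrix_(i, j) c i b j.
pose N : 'M[k]_(m b, n a) := \matrix_(j, i) d b j i.
apply: (@mulmx1_min _ _ _ M N); apply/matrixP => i i'; rewrite !mxE cd.
rewrite (bigD1 b) //= [X in _ + X]big1 ?addr0; last first.
  by move=> b' b'b; apply: zero => Jb'; move/eqP: b'b; apply; apply: J_inj; rewrite Jb.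
by apply: eq_bigr => j _; rewrite !mxE.
Qed.
End Uniqueness.

(** Inequalities hold in both directions, and injectivity of [I] and [J] makes the two choices of
    matching intervals inverse to each other. *)
Theorem decomposition_unique (R : realType) (k : fieldType) (F : sheaf k R)
    (A B : finType) (I : A -> set R) (n : A -> nat) (J : B -> set R) (m : B -> nat) :
  interval_decomposition F I n -> interval_decomposition F J m ->
  injective I -> injective J ->
  exists sigma : A -> B, bijective sigma /\
    forall a, J (sigma a) = I a /\ m (sigma a) = n a.
Proof.
move=> [iI I0 n0 isoG] [iJ J0 m0 isoH] I_inj J_inj.
have /choice[U UI] := fun a => interval_locally_closed (iI a).
have /choice[V VJ] := fun b => interval_locally_closed (iJ b).
have cI a : connected (I a) by apply/connected_intervalP.
have cJ b : connected (J b) by apply/connected_intervalP.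
have GH := sheaf_iso_span isoG isoH.
have HG := sheaf_iso_span isoH isoG.
have /choice[f fP] := fun a =>
  multiplicity_le UI VJ cI cJ J_inj (I0 a) (n0 a) GH.
have /choice[g gP] := fun b =>
  multiplicity_le VJ UI cJ cI I_inj (J0 b) (m0 b) HG.
have fK : cancel f g.
  by move=> a; apply: I_inj; have [-> _] := gP (f a); have [] := fP a.
have gK : cancel g f.
  by move=> b; apply: J_inj; have [-> _] := fP (g b); have [] := gP b.
exists f; split; first by exists g.
move=> a; have [JI nm] := fP a; split=> //; apply/eqP; rewrite eqn_leq nm andbT.
by have [_] := gP (f a); rewrite fK.
Qed.

Theorem corollary7p3 (R : realType) (k : fieldType) (F : sheaf k R)
    (F_constructible : constructible F) (F_compact : compact (sheaf_supp F)) :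
  (exists (A : finType) (I : A -> set R) (n : A -> nat),
    interval_decomposition F I n) /\
  (forall (A B : finType) (I : A -> set R) (n : A -> nat)
      (J : B -> set R) (m : B -> nat),
    interval_decomposition F I n -> interval_decomposition F J m ->
    injective I -> injective J ->
    exists sigma : A -> B, bijective sigma /\
      forall a, J (sigma a) = I a /\ m (sigma a) = n a).
Proof.
split; first exact: constructible_decomposition.
move=> A B I n J m; exact: decomposition_unique.
Qed.
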